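(* (Multiplication) Let $(\mathsf A_\pm,\mathsf T_\pm)$ be abstract spaces with skeletons $\Gamma_\pm$, where $\mathsf A_+=\{0\}\cup\mathsf A_+'$ with $\alpha:=\min\mathsf A_+'>0$, $\mathsf T_0=\mathbb R$, and $\overline\beta_-:=\max\mathsf A_-<0$, and let $(\mathsf A,\mathsf T,\Gamma)$ be their product and $(\overline{\mathsf A},\overline{\mathsf T},\overline\Gamma)$ its extension as defined in the context. Let $V_{u_+}\in\mathcal D^{\overline\alpha_+}(\mathsf T_+;\Gamma_+)$ with $\overline\alpha_+>0$, $V_{u_-}\in\mathcal D^{\overline\alpha_-}(\mathsf T_-;\Gamma_-)$ with $\overline\alpha_-<0$, $N_*>0$, and assume that $\kappa:=(\overline\alpha_++\min\mathsf A_-)\wedge(\alpha+\overline\alpha_-)$ satisfies $\kappa-\alpha\notin\mathsf A$ and $\kappa-\alpha>\overline\beta_-$. Then $\overline\Gamma$ is a skeleton on $(\overline{\mathsf A},\overline{\mathsf T})$ with $$\|\overline\Gamma\|_{sk}\le\|\Gamma\|_{sk}+\frac1{N_*}[V_{u_-}]_{\mathcal D^{\overline\alpha_-}(\mathsf T_-;\Gamma_-)}.$$ In addition, the form $V_{u_+\diamond u_-}\in C^0(\mathbb R^2;\overline{\mathsf T}^* )$ defined by $$V_{u_+\diamond u_-}.\begin{pmatrix}\mathsf u_-\\\mathsf v\end{pmatrix}:=u_+\mathsf u_-+(\overline V_{u_+}\otimes V_{u_-}).\mathsf v$$ belongs to $\mathcal D^\kappa(\overline{\mathsf T};\overline\Gamma)$,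 and more precisely: (1) for all $x\in\mathbb R^2$ and $(\mathsf u_-,\mathsf v)\in\overline{\mathsf T}$ $$\Big|V_{u_+\diamond u_-}(x).\begin{pmatrix}\mathsf u_-\\\mathsf v\end{pmatrix}\Big|\le N_*\|u_+\|\,\Big\|\overline\Gamma_{\kappa-\alpha}(x)\begin{pmatrix}\mathsf u_-\\\mathsf v\end{pmatrix}\Big\|_{\overline{\mathsf T}_{\kappa-\alpha}}+M^b\sum_{\beta\in\mathsf A}N^{\langle\beta\rangle}\|\Gamma_\beta(x)\mathsf v\|_{\mathsf T_\beta};$$ (2) for all $x,y$ with $d(y,x)\le1$ and $(\mathsf u_-,\mathsf v)\in\overline{\mathsf T}$ $$\Big|(V_{u_+\diamond u_-}(y)-V_{u_+\diamond u_-}(x)).\begin{pmatrix}\mathsf u_-\\\mathsf v\end{pmatrix}\Big|\le N_*[u_+]_\alpha d^\alpha(y,x)\Big\|\overline\Gamma_{\kappa-\alpha}(x)\begin{pmatrix}\mathsf u_-\\\mathsf v\end{pmatrix}\Big\|_{\overline{\mathsf T}_{\kappa-\alpha}}+M^c\sum_{\beta\in\mathsf A}d^{(\kappa-\beta)\vee0}(y,x)\|\Gamma_\beta(x)\mathsf v\|_{\mathsf T_\beta},$$ where $$M^b:=\|V_{u_+}\|_{\mathsf T_+;\Gamma_+}\|V_{u_-}\|_{\mathsf T_-;\Gamma_-},$$ $$M^c:=\big(N^{\min_{\beta\in\mathsf A_+'}\langle\beta\rangle_+}\|\overline V_{u_+}\|_{\mathsf T_+;\Gamma_+}+[u_+]_\alpha+[V_{u_+}]_{\mathcal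 D^{\overline\alpha_+}(\mathsf T_+;\Gamma_+)}\big)[V_{u_-}]_{\mathcal D^{\overline\alpha_-}(\mathsf T_-;\Gamma_-)}+N^{\min_{\beta\in\mathsf A_-}\langle\beta\rangle_-}[V_{u_+}]_{\mathcal D^{\overline\alpha_+}(\mathsf T_+;\Gamma_+)}\|V_{u_-}\|_{\mathsf T_-;\Gamma_-}.$$
   Context: $d(x,y)=|x_1-y_1|+\sqrt{|x_2-y_2|}$ on $\mathbb R^2$; $\|\cdot\|$ is the supremum norm on $\mathbb R^2$ and $[u]_\alpha=\sup_{x\ne y}d^{-\alpha}(y,x)|u(y)-u(x)|$. Abstract space: a pair $(\mathsf A,\mathsf T)$ with $\mathsf A\subset\mathbb R$ finite and $\mathsf T=\bigoplus_{\beta\in\mathsf A}\mathsf T_\beta$ a direct sum of real Banach spaces, elements $\mathsf v=(\mathsf v_\beta)_\beta$. Skeleton: $\Gamma\in C^0(\mathbb R^2;\mathcal L(\mathsf T,\mathsf T))$ with components $\Gamma_\beta(x)\mathsf v:=(\Gamma(x)\mathsf v)_\beta$ such that $\Gamma_\beta(x)\mathsf v=\mathsf v_\beta+\sum_{\gamma<\beta}\Gamma^\gamma_\beta(x)\mathsf v_\gamma$ and, for some constant $C$, $\|(\Gamma_\beta(y)-\Gamma_\beta(x))\mathsf v\|_{\mathsf T_\beta}\le C\sum_{\gamma<\beta}d^{\beta-\gamma}(y,x)\|\Gamma_\gamma(x)\mathsf v\|_{\mathsf T_\gamma}$ for all $\beta,\mathsf v$ and $d(y,x)\le1$; the minimal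 $C$ is $\|\Gamma\|_{sk}$. Modelled distribution: $V\in C^0(\mathbb R^2;\mathsf T^* )$ is in $\mathcal D^{\overline\alpha}(\mathsf T;\Gamma)$ if, with finite constants, $|(V(y)-V(x)).\mathsf v|\le[V]_{\mathcal D^{\overline\alpha}(\mathsf T;\Gamma)}\sum_\beta d^{(\overline\alpha-\beta)\vee0}(y,x)\|\Gamma_\beta(x)\mathsf v\|_{\mathsf T_\beta}$ for $d(y,x)\le1$ and $|V(x).\mathsf v|\le\|V\|_{\mathsf T;\Gamma}\sum_\beta N^{\langle\beta\rangle}\|\Gamma_\beta(x)\mathsf v\|_{\mathsf T_\beta}$ (smallest constants); here $N\in(0,1]$ is a fixed parameter and $\langle\cdot\rangle$ assigns nonnegative exponents to homogeneities, denoted $\langle\cdot\rangle_\pm$ on $\mathsf A_\pm$ and $\langle\cdot\rangle$ on $\mathsf A$ and assumed to satisfy $\langle\beta_+\rangle_++\langle\beta_-\rangle_-\ge\langle\beta_++\beta_-\rangle$. Reduction: every $V$ can be written uniquely as $V.\mathsf v=\sum_\beta\tilde V_\beta.\Gamma_\beta\mathsf v$ with $\tilde V_\beta(x)\in\mathsf T_\beta^*$; $C_\eta V.\mathsf v:=\sum_{\beta<\eta}\tilde V_\beta.\Gamma_\beta\mathsf v$ for $\min\mathsf A<\eta\le\max\mathsf A$. $C_\alpha V_{u_+}$ depends only on the $\mathsf T_0=\mathbb R$ component and is identified with the function $u_+\in C^0(\mathbb R^2)$ via $C_\alpha V_{u_+}.\mathsf v_+=u_+\,(\mathsf v_+)_0$;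 $\overline V_{u_+}:=V_{u_+}-C_\alpha V_{u_+}$. Product: $\mathsf A=\mathsf A_++\mathsf A_-$; $\mathsf T=\mathsf T_+\otimes\mathsf T_-$ (completed in a crossnorm) $=\bigoplus_{\beta\in\mathsf A}\mathsf T_\beta$, $\mathsf T_\beta=\bigoplus_{\beta_++\beta_-=\beta}\mathsf T_{\beta_+}\otimes\mathsf T_{\beta_-}$ with the sum of the norms; elements have components $\mathsf v_{\beta_+,\beta_-}$; $\Gamma(x)=\Gamma_+(x)\otimes\Gamma_-(x)$. The crossnorm is assumed uniform: for bounded operators $A_\pm$, $B_\pm$ defined on (finite direct sums, with sum norms, of) the graded pieces of $\mathsf T_\pm$ with values in such spaces or in finite-dimensional spaces, $A_+\otimes A_-$ (determined by $(A_+\otimes A_-)(\mathsf v_+\otimes\mathsf v_-)=A_+\mathsf v_+\otimes A_-\mathsf v_-$) is bounded, depends boundedly and bilinearly on $(A_+,A_-)$, and if $\|A_\pm\mathsf v_\pm\|\le\|B_\pm\mathsf v_\pm\|$ for all $\mathsf v_\pm$, then $\|(A_+\otimes A_-)\mathsf v\|\le\|(B_+\otimes B_-)\mathsf v\|$ for all $\mathsf v$. Extension: $\overline{\mathsf A}=\{\kappa-\alpha\}\cup\mathsf A$, $\overline{\mathsf T}=\overline{\mathsf T}_{\kappa-\alpha}\oplus\mathsf T\ni(\mathsf u_-,\mathsf v)$ with $\overline{\mathsf T}_{\kappa-\alpha}=\mathbb R$ normed by $\frac1{N_*}|\cdot|$; $\overline\Gamma_\beta(\mathsf u_-,\mathsf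 v)=\Gamma_\beta\mathsf v$ for $\beta\neq\kappa-\alpha$, and $\overline\Gamma_{\kappa-\alpha}(\mathsf u_-,\mathsf v)=\mathsf u_--V_{u_-}.\mathsf v_-$ with $\mathsf v_-:=(\mathsf v_{0,\beta_-})_{\beta_-\in\mathsf A_-}\in\mathsf T_-$. *)

(* Defs.v *)
From HB Require Import structures.
From mathcomp Require Import all_boot all_order all_algebra.
From mathcomp Require Import finmap.
From mathcomp Require Import all_classical all_reals all_analysis.
Set Implicit Arguments.
Unset Strict Implicit.
Unset Printing Implicit Defensive.
Import Order.TTheory GRing.Theory Num.Theory.
Import numFieldNormedType.Exports.
Local Open Scope classical_set_scope.
Local Open Scope ring_scope.

(* The finite direct sum of Banach spaces, with the sum of the norms. *)
Definition dsum (R : realType) (I : finType) (T : I -> completeNormedModType R)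
  : Type := forall i, T i.

HB.instance Definition _ (R : realType) (I : finType)
  (T : I -> completeNormedModType R) := gen_eqMixin (dsum T).
HB.instance Definition _ (R : realType) (I : finType)
  (T : I -> completeNormedModType R) := gen_choiceMixin (dsum T).

Section DirectSum.
Context {R : realType} {I : finType} (T : I -> completeNormedModType R).
Implicit Types u v w : dsum T.

Let add u v : dsum T := fun i => u i + v i.
Let opp u : dsum T := fun i => - u i.
Let zero : dsum T := fun i => 0.
Let scale (a : R) u : dsum T := fun i => a *: u i.

Fact dsum_addA : associative add.
Proof. by move=> u v w; apply: functional_extensionality_dep => i; exact: addrA. Qed.
Fact dsum_addC : commutative add.
Proof. by move=> u v; apply: functional_extensionality_dep => i; exact: addrC. Qed.
Fact dsum_add0 : left_id zero add.
Proof. by move=> u; apply: functional_extensionality_dep => i; exact: add0r. Qed.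
Fact dsum_addN : left_inverse zero opp add.
Proof. by move=> u; apply: functional_extensionality_dep => i; exact: addNr. Qed.

HB.instance Definition _ := GRing.isZmodule.Build (dsum T)
  dsum_addA dsum_addC dsum_add0 dsum_addN.

Fact dsum_scaleA a b v : scale a (scale b v) = scale (a * b) v.
Proof. by apply: functional_extensionality_dep => i; exact: scalerA. Qed.
Fact dsum_scale1 : left_id 1 scale.
Proof. by move=> u; apply: functional_extensionality_dep => i; exact: scale1r. Qed.
Fact dsum_scaleDr : right_distributive scale +%R.
Proof. by move=> a u v; apply: functional_extensionality_dep => i; exact: scalerDr. Qed.
Fact dsum_scaleDl v : {morph scale^~ v : a b / a + b}.
Proof. by move=> a b; apply: functional_extensionality_dep => i; exact: scalerDl. Qed.

HB.instance Definition _ := GRing.Zmodule_isLmodule.Build R (dsum T)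
  dsum_scaleA dsum_scale1 dsum_scaleDr dsum_scaleDl.

Definition dsum_norm u : R := \sum_i `|u i|.

Fact dsum_normD u v : dsum_norm (u + v) <= dsum_norm u + dsum_norm v.
Proof. by rewrite -big_split /=; apply: ler_sum => i _; exact: ler_normD. Qed.
Fact dsum_normZ (a : R) u : dsum_norm (a *: u) = `|a| * dsum_norm u.
Proof. by rewrite /dsum_norm mulr_sumr; apply: eq_bigr => i _; exact: normrZ. Qed.
Fact dsum_norm0 u : dsum_norm u = 0 -> u = 0.
Proof.
move=> u0; apply: functional_extensionality_dep => i.
by apply/normr0_eq0; apply: (psumr_eq0P _ u0).
Qed.

HB.instance Definition _ := Lmodule_isNormed.Build R (dsum T)
  dsum_normD dsum_normZ dsum_norm0.

Lemma dsum_normE u : `|u| = \sum_i `|u i|. Proof. by []. Qed.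

Fact dsum_complete (F : set_system (dsum T)) :
  ProperFilter F -> cauchy F -> cvg F.
Proof.
move=> FF /cauchy_ballP Fc.
have Fcoord i : cauchy ((fun u => u i) @ F).
  apply/cauchy_ballP => e e0; have := Fc e e0.
  case=> -[A B] /= [FA FB] AB.
  exists ((fun u : dsum T => u i) @` A, (fun u : dsum T => u i) @` B) => /=.
    by split; [apply: filterS FA => u|apply: filterS FB => u]; exists u.
  move=> [_ _] /= [[u Au <-] [v Bv <-]].
  have := AB (u, v) (conj Au Bv); rewrite -!ball_normE /=.
  by apply: le_lt_trans; rewrite dsum_normE (bigD1 i)//= lerDl sumr_ge0.
have Fcvg i : cvg ((fun u : dsum T => u i) @ F).
  by apply: cauchy_cvg; exact: Fcoord.
pose l : dsum T := fun i => lim ((fun u : dsum T => u i) @ F).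
apply/cvg_ex; exists l; apply/cvgrPdist_le => e e0.
pose e' := e / #|I|.+1%:R.
have e'0 : 0 < e' by rewrite divr_gt0.
have : \forall u \near F, forall i : I, `|l i - (u i : T i)| <= e'.
  apply: filter_forall => i.
  by have /cvgrPdist_le/(_ _ e'0) := Fcvg i.
apply: filterS => u ul.
rewrite dsum_normE (le_trans (ler_sum _ (fun i _ => ul i)))//.
rewrite sumr_const -mulr_natr /e' mulrAC ler_pdivrMr// ler_wpM2l ?ltW//.
by rewrite ltr_nat ltnS max_card.
Qed.

HB.instance Definition _ := Uniform_isComplete.Build (dsum T) dsum_complete.

End DirectSum.

(* The real line normed by c^-1 * `|.|. *)
Definition scaled_line (R : realType) (c : {posnum R}) : Type := R.

Section ScaledLine.
Context {R : realType} (c : {posnum R}).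
HB.instance Definition _ := GRing.Lmodule.copy (scaled_line c) R^o.

Definition scaled_norm (x : scaled_line c) : R := c%:num^-1 * `|x : R|.

Fact scaled_normD x y : scaled_norm (x + y) <= scaled_norm x + scaled_norm y.
Proof. by rewrite -mulrDr ler_wpM2l// ler_normD. Qed.
Fact scaled_normZ (a : R) x : scaled_norm (a *: x) = `|a| * scaled_norm x.
Proof. by rewrite /scaled_norm [LHS]/= normrM mulrCA. Qed.
Fact scaled_norm0 x : scaled_norm x = 0 -> x = 0.
Proof.
by move/eqP; rewrite mulf_eq0 invr_eq0 gt_eqF//= normr_eq0 => /eqP.
Qed.

HB.instance Definition _ := Lmodule_isNormed.Build R (scaled_line c)
  scaled_normD scaled_normZ scaled_norm0.

Lemma scaled_normE (x : scaled_line c) : `|x| = c%:num^-1 * `|x : R|.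
Proof. by []. Qed.

Fact scaled_complete (F : set_system (scaled_line c)) :
  ProperFilter F -> cauchy F -> cvg F.
Proof.
move=> FF /cauchy_ballP Fc.
have FR : ProperFilter (F : set_system R) by exact: FF.
have : cauchy (F : set_system R).
  apply/cauchy_ballP => e e0; have := Fc (c%:num^-1 * e).
  rewrite mulr_gt0// => /(_ isT); apply: filterS => -[x y] /=.
  rewrite -!ball_normE /= scaled_normE ltr_pM2l//.
move=> /cauchy_cvgP/cvg_ex[l Fl]; apply/cvg_ex; exists (l : scaled_line c).
apply/cvgrPdist_le => e e0.
have /cvgrPdist_le := Fl => /(_ (c%:num * e)); rewrite mulr_gt0// => /(_ isT).
by apply: filterS => x; rewrite scaled_normE ler_pdivrMl.
Qed.

HB.instance Definition _ := Uniform_isComplete.Build (scaled_line c) scaled_complete.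
End ScaledLine.

Notation plane R := (R * R)%type.

Definition pdist (R : realType) (x y : plane R) : R :=
  `|x.1 - y.1| + Num.sqrt `|x.2 - y.2|.

Definition sup_norm (R : realType) (u : plane R -> R) : R :=
  sup (range (fun x => `|u x|)).

Definition hoelder_seminorm (R : realType) (a : R) (u : plane R -> R) : R :=
  sup [set r | exists x y : plane R,
    x != y /\ r = pdist y x `^ (- a) * `|u y - u x| ].

Definition bounded_linear (R : realType) (X Y : normedModType R) (f : X -> Y) :=
  linear f /\ exists C : R, forall v, `|f v| <= C * `|v|.

(* C^0 of the plane with values in the bounded operators, for the operator
   norm. *)
Definition C0_op (R : realType) (X Y : normedModType R)
    (F : plane R -> X -> Y) :=
  (forall x, bounded_linear (F x)) /\
  (forall x (e : R), 0 < e ->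
     \forall y \near x, forall v, `|F y v - F x v| <= e * `|v|).

(* The finite set of homogeneities is presented as the injective image of a
   finite type. *)
Record abstract_space (R : realType) := AbstractSpace {
  idx : finType;
  homog : idx -> R;
  homog_inj : injective homog;
  piece : idx -> completeNormedModType R }.

Notation graded_sum S := (dsum (@piece _ S)).

(* Minimum and maximum when the index set is nonempty; both are 0 on the empty
   set, so 0 < min_homog S and max_homog S < 0 force nonemptiness. *)
Definition min_homog (R : realType) (S : abstract_space R) : R := inf (range (@homog _ S)).
Definition max_homog (R : realType) (S : abstract_space R) : R := sup (range (@homog _ S)).

Section Adjoin.
Context {R : realType} (b : R) (X : completeNormedModType R).
Context (S : abstract_space R) (bS : forall i : idx S, homog i != b).

Definition adjoin_homog (o : option (idx S)) : R := if o is Some i then homog i else b.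
Definition adjoin_piece (o : option (idx S)) : completeNormedModType R :=
  if o is Some i then piece i else X.

Fact adjoin_homog_inj : injective adjoin_homog.
Proof.
move=> [i|] [j|] //= => [/homog_inj->//|/eqP|/esym/eqP]; by rewrite (negPf (bS _)).
Qed.

(* {b} \cup A and X (+) T; the new index is None. *)
Definition adjoin : abstract_space R :=
  @AbstractSpace R _ adjoin_homog adjoin_homog_inj adjoin_piece.

Definition adjoin_rest (w : graded_sum adjoin) : graded_sum S := fun i => w (Some i).

End Adjoin.

Fact min_homog_gt0_neq0 (R : realType) (S : abstract_space R) :
  0 < min_homog S -> forall i : idx S, homog i != 0.
Proof.
move=> S0 i; rewrite gt_eqF// (lt_le_trans S0)//; apply: ge_inf; last by exists i.
exists (- \sum_(j : idx S) `|homog j|) => _ [j _ <-].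
rewrite lerNl (le_trans (ler_norm _))// normrN (bigD1 j)//= lerDl.
by rewrite sumr_ge0.
Qed.

Section Skeleton.
Context {R : realType} (S : abstract_space R).
Implicit Types (G : plane R -> graded_sum S -> graded_sum S) (V : plane R -> graded_sum S -> R^o).

Definition triangular G := exists
  g : forall (x : plane R) (b c : idx S), piece c -> piece b,
  (forall x b c, bounded_linear (g x b c)) /\
  (forall x v b, G x v b = v b + \sum_(c | homog c < homog b) g x b c (v c)).

(* The seminorms below are infima of the admissible constants C >= 0; since the
   conditions are closed in C, a nonempty set of constants has a minimum. *)
Definition skeleton_bound G (C : R) := 0 <= C /\
  forall x y b v, pdist y x <= 1 ->
    `|G y v b - G x v b| <=
      C * \sum_(c | homog c < homog b) pdist y x `^ (homog b - homog c) * `|G x v c|.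

(* G \in C^0(R^2; L(T, T)) is a skeleton. *)
Definition is_skeleton G :=
  [/\ C0_op G, triangular G & exists C, skeleton_bound G C].

Definition skeleton_norm G : R := inf [set C | skeleton_bound G C].

Definition increment_bound G (a : R) V (C : R) := 0 <= C /\
  forall x y v, pdist y x <= 1 ->
    `|V y v - V x v| <=
      C * \sum_b pdist y x `^ (Num.max (a - homog b) 0) * `|G x v b|.

Definition size_bound (N : R) (br : idx S -> R) G V (C : R) := 0 <= C /\
  forall x v, `|V x v| <= C * \sum_b N `^ br b * `|G x v b|.

(* V \in D^a(T; G) *)
Definition modelled N br G a V :=
  [/\ C0_op V, exists C, increment_bound G a V C
    & exists C, size_bound N br G V C].

Definition modelled_seminorm G a V : R := inf [set C | increment_bound G a V C].
Definition modelled_norm N br G V : R := inf [set C | size_bound N br G V C].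

(* The coefficients W of the unique writing V.v = sum_b W_b.(G_b v). *)
Definition reduction G V : plane R -> forall b : idx S, piece b -> R^o :=
  xget (fun _ _ _ => 0) [set W : plane R -> forall b : idx S, piece b -> R^o |
    (forall x b, bounded_linear (W x b)) /\
    (forall x v, V x v = \sum_b W x b (G x v b)) ].

Definition cutoff G (eta : R) V : plane R -> graded_sum S -> R^o :=
  fun x v => \sum_(b | homog b < eta) reduction G V x (G x v b).

End Skeleton.

Section Tensor.
Context {R : realType}.

(* A norm on the algebraic tensor product of X and Y for which
   |u (x) v| = |u| |v|, together with its completion Z. *)
Definition crossnorm_completion (X Y Z : normedModType R) (t : X -> Y -> Z) :=
  [/\ (forall u, linear (t u)) /\ (forall v, linear (t^~ v)),
      forall u v, `|t u v| = `|u| * `|v|,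
      (* t is injective on the algebraic tensor product *)
      forall n (u : 'I_n -> X) (v : 'I_n -> Y),
        (forall c : 'I_n -> R, \sum_i c i *: u i = 0 -> forall i, c i = 0) ->
        \sum_i t (u i) (v i) = 0 -> forall i, v i = 0
    & closure [set z | exists n (u : 'I_n -> X) (v : 'I_n -> Y),
                 z = \sum_i t (u i) (v i)] = setT ].

(* B = A1 (x) A2, where s and t are the maps sending a pair of vectors to its
   elementary tensor. *)
Definition is_tensor_op (X1 X2 X Y1 Y2 Y : normedModType R)
    (s : X1 -> X2 -> X) (t : Y1 -> Y2 -> Y)
    (A1 : X1 -> Y1) (A2 : X2 -> Y2) (B : X -> Y) :=
  bounded_linear B /\ forall u v, B (s u v) = t (A1 u) (A2 v).

Definition tensor_op (X1 X2 X Y1 Y2 Y : normedModType R)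
    (s : X1 -> X2 -> X) (t : Y1 -> Y2 -> Y)
    (A1 : X1 -> Y1) (A2 : X2 -> Y2) : X -> Y :=
  xget (fun=> 0) [set B | is_tensor_op s t A1 A2 B].

Definition finite_dimensional (X : lmodType R) :=
  exists n (e : 'I_n -> X), forall v, exists c : 'I_n -> R, v = \sum_i c i *: e i.

(* The spaces on which tensor products are formed: the graded pieces, their
   finite direct sums (repetitions allowed), and finite-dimensional spaces. *)
Inductive factor (S : abstract_space R) :=
| Piece of idx S
| Sums (J : finType) of J -> idx S
| Findim (X : completeNormedModType R) of finite_dimensional X.

Definition space_of (S : abstract_space R) (c : factor S)
    : completeNormedModType R :=
  match c with
  | Piece i => piece i
  | Sums J f => dsum (fun j => piece (f j))
  | Findim X _ => X
  end.

Definition graded (S : abstract_space R) (c : factor S) : bool :=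
  if c is Findim _ _ then false else true.

(* space_of (whole S) is convertible to graded_sum S *)
Definition whole (S : abstract_space R) : factor S := Sums id.

Record tensor_system (Sp Sm : abstract_space R) := TensorSystem {
  tens : factor Sp -> factor Sm -> completeNormedModType R;
  pure : forall c d, space_of c -> space_of d -> tens c d }.

End Tensor.

Section Product.
Context {R : realType} (Sp Sm : abstract_space R) (K : tensor_system Sp Sm).

(* A_+ + A_- *)
Definition prod_homogs : {fset R} :=
  [fset (homog p.1 + homog p.2)%R | p : idx Sp * idx Sm]%fset.

Definition prod_piece (b : prod_homogs) : completeNormedModType R :=
  dsum (fun p : {p : idx Sp * idx Sm | homog p.1 + homog p.2 == fsval b} =>
    tens K (Piece (val p).1) (Piece (val p).2)).

Definition prod_space : abstract_space R :=
  @AbstractSpace R prod_homogs (@fsval _ _) val_inj prod_piece.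

Fact prod_homog_in (i : idx Sp) (j : idx Sm) : homog i + homog j \in prod_homogs.
Proof. by apply/imfsetP; exists (i, j). Qed.

Definition prod_idx (i : idx Sp) (j : idx Sm) : idx prod_space :=
  [` prod_homog_in i j]%fset.

Definition component (v : graded_sum prod_space) (i : idx Sp) (j : idx Sm)
    : tens K (Piece i) (Piece j) :=
  (v (prod_idx i j) : prod_piece _) (exist _ (i, j) (eqxx _)).

Definition prod_pure (u : graded_sum Sp) (v : graded_sum Sm) : graded_sum prod_space :=
  fun b => (fun p => pure K (c := Piece _) (d := Piece _)
                          (u (val p).1) (v (val p).2)) : prod_piece b.

(* In the domination clause the dominating operators B1, B2 take values in
   graded spaces only.  Admitting arbitrary finite-dimensional spaces there as
   well would contradict the sum norm on T when both factors have many pieces: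
   by Grothendieck's inequality the projective norm, the largest crossnorm on
   l_oo^N (x) l_oo^N, does not dominate that of l_1 (x) l_1 along Euclidean
   subspaces.
   Bilinearity of (A1, A2) |-> A1 (x) A2 follows from the density of the
   elementary tensors. *)
Definition uniform_crossnorm :=
  [/\ forall c d, crossnorm_completion (@pure _ _ _ K c d),
      (* T_+ (x) T_- is the direct sum of the T_b, with the sum of the norms *)
      exists f : tens K (whole Sp) (whole Sm) -> graded_sum prod_space,
        [/\ linear f, forall w, `|f w| = `|w|, forall v, exists w, f w = v &
            forall u v, f (pure K (c := whole Sp) (d := whole Sm) u v) =
                        prod_pure u v],
      forall (c c' : factor Sp) (d d' : factor Sm), graded c -> graded d ->
        exists M : R, forall (A1 : space_of c -> space_of c')
                             (A2 : space_of d -> space_of d'),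
          bounded_linear A1 -> bounded_linear A2 ->
          exists2 B, is_tensor_op (pure K (c := c) (d := d))
                                  (pure K (c := c') (d := d')) A1 A2 B &
            forall a1 a2 : R,
              0 <= a1 -> (forall u, `|A1 u| <= a1 * `|u|) ->
              0 <= a2 -> (forall v, `|A2 v| <= a2 * `|v|) ->
              forall w, `|B w| <= M * a1 * a2 * `|w|
    & forall (c c' c'' : factor Sp) (d d' d'' : factor Sm),
        graded c -> graded d -> graded c'' -> graded d'' ->
        forall (A1 : space_of c -> space_of c') (A2 : space_of d -> space_of d')
               (B1 : space_of c -> space_of c'') (B2 : space_of d -> space_of d''),
          bounded_linear A1 -> bounded_linear A2 ->
          bounded_linear B1 -> bounded_linear B2 ->
          (forall u, `|A1 u| <= `|B1 u|) -> (forall v, `|A2 v| <= `|B2 v|) ->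
          forall w : tens K c d,
            `|tensor_op (pure K (c := c) (d := d))
                        (pure K (c := c') (d := d')) A1 A2 w| <=
            `|tensor_op (pure K (c := c) (d := d))
                        (pure K (c := c'') (d := d'')) B1 B2 w| ].

Definition prod_skeleton (Gp : plane R -> graded_sum Sp -> graded_sum Sp)
    (Gm : plane R -> graded_sum Sm -> graded_sum Sm)
    : plane R -> graded_sum prod_space -> graded_sum prod_space :=
  fun x => tensor_op prod_pure prod_pure (Gp x) (Gm x).

(* V1 (x) V2 with values in R (x) R = R *)
Definition tensor_form (V1 : graded_sum Sp -> R^o) (V2 : graded_sum Sm -> R^o)
    : graded_sum prod_space -> R^o :=
  tensor_op prod_pure (fun a b : R^o => a * b) V1 V2.

End Product.

Section Multiplication.
Context {R : realType} (Sp' Sm : abstract_space R).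
Context (Sp'0 : forall i : idx Sp', homog i != 0).
Local Notation Sp := (adjoin R^o Sp'0).
Context (K : tensor_system Sp Sm).
Context (kappa_alpha : R) (hka : forall b : idx (prod_space K), homog b != kappa_alpha).
Context (Ns : {posnum R}).
Local Notation Tbar := (adjoin (scaled_line Ns) hka).

(* v_- = (v_{0,b}), b in A_-, with R (x) T_b identified with T_b; the piece
   T_0 = R of the left factor is at None. *)
Definition minus_part (v : graded_sum (prod_space K)) : graded_sum Sm := fun j =>
  tensor_op (pure K (c := Piece (None : idx Sp)) (d := Piece j))
    (fun (a : R^o) (w : piece j) => a *: w) id id
    (component v (None : idx Sp) j).

Definition ext_skeleton (Vm : plane R -> graded_sum Sm -> R^o)
    (G : plane R -> graded_sum (prod_space K) -> graded_sum (prod_space K))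
    : plane R -> graded_sum Tbar -> graded_sum Tbar :=
  fun x w o => match o return adjoin_piece (scaled_line Ns) o with
    | None => (w None : R) - Vm x (minus_part (adjoin_rest w))
    | Some b => G x (adjoin_rest w) b
    end.

Definition prod_form (u : plane R -> R) (Vp_bar : plane R -> graded_sum Sp -> R^o)
    (Vm : plane R -> graded_sum Sm -> R^o) : plane R -> graded_sum Tbar -> R^o :=
  fun x w => u x * (w None : R)
             + tensor_form (Vp_bar x) (Vm x) (adjoin_rest w).

End Multiplication.

(* Main.v *)
Require Import Defs.
From HB Require Import structures.
From mathcomp Require Import all_boot all_order all_algebra.
From mathcomp Require Import finmap.
From mathcomp Require Import all_classical all_reals all_analysis.
From mathcomp Require Import ring lra.
Set Implicit Arguments.
Unset Strict Implicit.
Unset Printing Implicit Defensive.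
Import Order.TTheory GRing.Theory Num.Theory.
Import numFieldNormedType.Exports.
Local Open Scope classical_set_scope.
Local Open Scope ring_scope.

(* By the uniformity of the crossnorm, bounds |A u| <= sum_i a_i |Gp_i(x) u| and
   |B v| <= sum_j b_j |Gm_j(x) v| give
     |(A (x) B) w| <= sum_ij a_i b_j |(G(x) w)_ij|,
   because the right-hand side is the norm of w under the tensor product of the
   weighted skeletons.  The estimates (1) and (2) follow by applying this to
     V(x) = u(x) Gbar_{kappa-alpha}(x) + Vp(x) (x) Vm(x)
   and to
     V(y) - V(x) = (u(y) - u(x)) Gbar_{kappa-alpha}(x)
                 + Vp_bar(y) (x) (Vm(y) - Vm(x)) + (Vp(y) - Vp(x)) (x) Vm(x),
   with Vp_bar(y) = Vp_bar(x) + (Vp(y) - Vp(x)) - (u(y) - u(x)) pi_0.  Since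
   kappa - alpha > max A_- >= min A_-, the exponent alphap exceeds alpha; hence u
   is alpha-Hoelder, and every product of powers of d(y, x) that occurs is at
   most the required d^((kappa - beta) v 0). *)

(** * Bounded linear maps *)

(** The operators [tensor_op] and the coefficients [reduction] are chosen, not constructed. So every
    identity between tensor operators is proved by uniqueness: bounded linear maps that agree on
    elementary tensors agree everywhere, by density. Triangularity is used through invertibility:
    each skeleton is unipotent at every x, so there is a test vector v with any prescribed value of
    Gp(x) v. Such vectors read off u from Vp and remove the T_0 term from bounds on Vp_bar.

    The two entries of kappa are the exponents that remain when one factor is incremented. In Vp_bar
    (x) (increment of Vm), the left factor contributes alpha, either as its homogeneity or as
    d^alpha from the increment of u. In (increment of Vp) (x) Vm, the right homogeneity is at least
    min A_-. The condition kappa - alpha > max A_- puts all entries of v_- below the new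
    homogeneity, so that the new row of Gbar is triangular. The inequality kappa - alpha <= alpham
    turns the increment bound of Vm into the skeleton bound of that row, and 1/N_* is the norm of
    the new line. *)

Section LinearFunctions.
Context {R : realType} {X Y : lmodType R} (f : X -> Y) (f_lin : linear f).

Lemma lin0 : f 0 = 0.
Proof. by have := f_lin (-1) 0 0; rewrite scaler0 addr0 scaleN1r addNr. Qed.

Lemma linD u v : f (u + v) = f u + f v.
Proof. by rewrite -[u in LHS]scale1r f_lin scale1r. Qed.

Lemma linZ a u : f (a *: u) = a *: f u.
Proof. by rewrite -[a *: u in LHS]addr0 f_lin lin0 addr0. Qed.

Lemma linN u : f (- u) = - f u.
Proof. by rewrite -scaleN1r linZ scaleN1r. Qed.

Lemma linB u v : f (u - v) = f u - f v.
Proof. by rewrite linD linN. Qed.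

Lemma lin_sum (I : Type) (r : seq I) (P : pred I) (F : I -> X) :
  f (\sum_(i <- r | P i) F i) = \sum_(i <- r | P i) f (F i).
Proof. by apply: (big_morph f) => [u v|]; rewrite ?linD ?lin0. Qed.

End LinearFunctions.

Section BoundedLinear.
Context {R : realType}.
Implicit Types X Y Z : normedModType R.

Lemma bounded_linear_lin X Y (f : X -> Y) : bounded_linear f -> linear f.
Proof. by case. Qed.

Lemma bounded_linear_bound X Y (f : X -> Y) : bounded_linear f ->
  exists2 C : R, 0 <= C & forall v, `|f v| <= C * `|v|.
Proof.
move=> [_ [C fC]]; exists `|C| => // v.
by rewrite (le_trans (fC v))// ler_wpM2r// ler_norm.
Qed.

Lemma bounded_linear_id X : bounded_linear (@id X).
Proof. by split=> //; exists 1 => v; rewrite mul1r. Qed.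

Lemma bounded_linear0 X Y : bounded_linear (fun _ : X => 0 : Y).
Proof.
by split=> [a u v|]; [rewrite scaler0 addr0|exists 0 => v; rewrite normr0 mul0r].
Qed.

Lemma bounded_linearD X Y (f g : X -> Y) : bounded_linear f ->
  bounded_linear g -> bounded_linear (fun v => f v + g v).
Proof.
move=> [fl [C fC]] [gl [D gD]]; split=> [a u v|].
  by rewrite fl gl scalerDr addrACA.
exists (C + D) => v; rewrite mulrDl (le_trans (ler_normD _ _))//.
exact: lerD.
Qed.

Lemma bounded_linearZ X Y (c : R) (f : X -> Y) : bounded_linear f ->
  bounded_linear (fun v => c *: f v).
Proof.
move=> [fl [C fC]]; split=> [a u v|].
  by rewrite fl scalerDr !scalerA mulrC.
by exists (`|c| * C) => v; rewrite normrZ -mulrA ler_wpM2l.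
Qed.

Lemma bounded_linearN X Y (f : X -> Y) : bounded_linear f ->
  bounded_linear (fun v => - f v).
Proof.
move=> /(bounded_linearZ (-1)).
by congr bounded_linear; apply/funext => v; rewrite scaleN1r.
Qed.

Lemma bounded_linearB X Y (f g : X -> Y) : bounded_linear f ->
  bounded_linear g -> bounded_linear (fun v => f v - g v).
Proof. by move=> fb /bounded_linearN; exact: bounded_linearD. Qed.

Lemma bounded_linear_sum X Y (I : Type) (r : seq I) (P : pred I)
    (f : I -> X -> Y) : (forall i, bounded_linear (f i)) ->
  bounded_linear (fun v => \sum_(i <- r | P i) f i v).
Proof.
move=> fb; elim: r => [|i r ih].
  rewrite (_ : (fun v => _) = fun=> 0); first exact: bounded_linear0.
  by apply/funext => v; rewrite big_nil.
case: (boolP (P i)) => Pi; last first.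
  by move: ih; congr bounded_linear; apply/funext => v; rewrite big_cons (negPf Pi).
have := bounded_linearD (fb i) ih.
by congr bounded_linear; apply/funext => v; rewrite big_cons Pi.
Qed.

Lemma bounded_linear_comp X Y Z (f : Y -> Z) (g : X -> Y) :
  bounded_linear f -> bounded_linear g -> bounded_linear (fun v => f (g v)).
Proof.
move=> fb [gl [D gD]]; have [C C0 fC] := bounded_linear_bound fb.
split=> [a u v|]; first by rewrite gl (bounded_linear_lin fb).
by exists (C * D) => v; rewrite (le_trans (fC _))// -mulrA ler_wpM2l.
Qed.

Lemma bounded_linear_isometry X Y (f : X -> Y) :
  linear f -> (forall v, `|f v| = `|v|) -> bounded_linear f.
Proof. by move=> fl fi; split=> //; exists 1 => v; rewrite fi mul1r. Qed.

Section DirectSum.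
Context {I : finType} (T : I -> completeNormedModType R).

Lemma dsum_addE (u v : dsum T) i : (u + v) i = u i + v i. Proof. by []. Qed.
Lemma dsum_oppE (u : dsum T) i : (- u) i = - u i. Proof. by []. Qed.
Lemma dsum_scaleE a (u : dsum T) i : (a *: u) i = a *: u i. Proof. by []. Qed.

Lemma dsum_sumE (J : Type) (r : seq J) (P : pred J) (F : J -> dsum T) i :
  (\sum_(j <- r | P j) F j) i = \sum_(j <- r | P j) F j i.
Proof. by apply: (big_morph (fun u : dsum T => u i)). Qed.

Lemma dsum_ext (u v : dsum T) : (forall i, u i = v i) -> u = v.
Proof. by move=> uv; apply: functional_extensionality_dep. Qed.

Lemma ler_norm_coord (u : dsum T) i : `|u i| <= `|u|.
Proof. by rewrite dsum_normE (bigD1 i)//= lerDl sumr_ge0. Qed.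

Lemma bounded_linear_coord i : bounded_linear (fun u : dsum T => u i).
Proof. by split=> //; exists 1 => u; rewrite mul1r ler_norm_coord. Qed.

Lemma bounded_linear_dsum X (f : X -> dsum T) :
  (forall i, bounded_linear (fun v => f v i)) -> bounded_linear f.
Proof.
move=> fb; split=> [a u v|].
  by apply: dsum_ext => i; exact: (bounded_linear_lin (fb i)).
have /choice[C fC] i : exists C : R, forall v, `|f v i| <= C * `|v|.
  by have [_] := fb i.
exists (\sum_i C i) => v.
by rewrite dsum_normE mulr_suml; apply: ler_sum => i _.
Qed.

(** The entry at j has type [T j], so w has to be transported along the decided equality of i and
    j. *)
Definition dsum_inj i (w : T i) : dsum T := fun j =>
  if eqVneq i j is EqNotNeq e then ecast k (T k) e w else 0.

Lemma dsum_injE i (w : T i) : dsum_inj w i = w.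
Proof. by rewrite /dsum_inj; case: eqVneq => [e|/eqP//]; rewrite eq_axiomK. Qed.

Lemma dsum_inj_neq i j (w : T i) : i != j -> dsum_inj w j = 0.
Proof. by rewrite /dsum_inj; case: eqVneq => // ->; rewrite eqxx. Qed.

Lemma norm_dsum_inj i (w : T i) : `|dsum_inj w| = `|w|.
Proof.
rewrite dsum_normE (bigD1 i)//= dsum_injE big1 ?addr0// => j ji.
by rewrite dsum_inj_neq ?normr0// eq_sym.
Qed.

Lemma linear_dsum_inj i : linear (@dsum_inj i).
Proof.
move=> a u v; apply: dsum_ext => j; rewrite dsum_addE dsum_scaleE.
have [<-|ij] := eqVneq i j; first by rewrite !dsum_injE.
by rewrite !dsum_inj_neq// scaler0 addr0.
Qed.

Lemma bounded_linear_dsum_inj i : bounded_linear (@dsum_inj i).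
Proof.
apply: bounded_linear_isometry => [|w]; first exact: linear_dsum_inj.
exact: norm_dsum_inj.
Qed.

Lemma dsum_decomp (u : dsum T) : u = \sum_i dsum_inj (u i).
Proof.
apply: dsum_ext => j; rewrite dsum_sumE (bigD1 j)//= dsum_injE.
by rewrite big1 ?addr0// => i ij; rewrite dsum_inj_neq.
Qed.

End DirectSum.
End BoundedLinear.

(** * Families of operators continuous in the operator norm *)

Section ContinuousFamilies.
Context {R : realType}.
Implicit Types X Y Z : normedModType R.

Lemma C0_opD X Y (F G : plane R -> X -> Y) : C0_op F -> C0_op G ->
  C0_op (fun x v => F x v + G x v).
Proof.
move=> [Fb Fc] [Gb Gc]; split=> [x|x e e0]; first exact: bounded_linearD.
have e20 : 0 < e / 2 by rewrite divr_gt0.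
apply: filterS2 (Fc x _ e20) (Gc x _ e20) => y Fy Gy v.
rewrite opprD addrACA (le_trans (ler_normD _ _))//.
by rewrite [e]splitr mulrDl lerD.
Qed.

Lemma C0_op_comp X Y Z (L : Y -> Z) (F : plane R -> X -> Y) :
  bounded_linear L -> C0_op F -> C0_op (fun x v => L (F x v)).
Proof.
move=> Lb [Fb Fc]; split=> [x|x e e0]; first exact: bounded_linear_comp.
have [C C0 LC] := bounded_linear_bound Lb.
(* C may be 0, so the tolerance is divided by C + 1. *)
have C1 : 0 < C + 1 by rewrite ltr_wpDl.
have eC : 0 < e / (C + 1) by rewrite divr_gt0.
apply: filterS (Fc x _ eC) => y Fy v.
rewrite -(linB (bounded_linear_lin Lb)) (le_trans (LC _))//.
apply: (@le_trans _ _ ((C + 1) * (e / (C + 1) * `|v|))).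
  by apply: ler_pM => //; rewrite lerDl.
by rewrite mulrA mulrCA mulfV ?gt_eqF// mulr1.
Qed.

Lemma C0_op_compr X Y Z (F : plane R -> Y -> Z) (L : X -> Y) :
  C0_op F -> bounded_linear L -> C0_op (fun x v => F x (L v)).
Proof.
move=> [Fb Fc] Lb; split=> [x|x e e0].
  exact: (bounded_linear_comp (Fb x)).
have [C C0 LC] := bounded_linear_bound Lb.
have C1 : 0 < C + 1 by rewrite ltr_wpDl.
have eC : 0 < e / (C + 1) by rewrite divr_gt0.
apply: filterS (Fc x _ eC) => y Fy v; rewrite (le_trans (Fy _))//.
apply: (@le_trans _ _ (e / (C + 1) * ((C + 1) * `|v|))).
  rewrite ler_wpM2l ?(ltW eC)// (le_trans (LC v))//.
  by rewrite ler_wpM2r// lerDl.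
by rewrite mulrA mulfVK ?gt_eqF.
Qed.

Lemma C0_op_const X Y (f : X -> Y) : bounded_linear f -> C0_op (fun=> f).
Proof.
move=> fb; split=> // x e e0; apply: (@filterE _ (nbhs x)) => y v.
by rewrite subrr normr0 mulr_ge0// ltW.
Qed.

Lemma C0_opN X Y (F : plane R -> X -> Y) :
  C0_op F -> C0_op (fun x v => - F x v).
Proof. exact: (C0_op_comp (bounded_linearN (bounded_linear_id Y))). Qed.

Lemma C0_op_scale X Y (c : plane R -> R) (f : X -> Y) :
  continuous c -> bounded_linear f -> C0_op (fun x v => c x *: f v).
Proof.
move=> cc fb; split=> [x|x e e0]; first exact: bounded_linearZ.
have [C C0 fC] := bounded_linear_bound fb.
have C1 : 0 < C + 1 by rewrite ltr_wpDl.
have eC : 0 < e / (C + 1) by rewrite divr_gt0.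
have /cvgrPdist_le/(_ _ eC) := cc x; apply: filterS => y cy v.
rewrite -scalerBl normrZ distrC.
apply: (@le_trans _ _ (e / (C + 1) * ((C + 1) * `|v|))).
  apply: ler_pM => //; rewrite (le_trans (fC v))//.
  by rewrite ler_wpM2r// lerDl.
by rewrite mulrA mulfVK ?gt_eqF.
Qed.

Lemma C0_op_dsum X (I : finType) (T : I -> completeNormedModType R)
    (F : plane R -> X -> dsum T) :
  (forall i, C0_op (fun x v => F x v i)) -> C0_op F.
Proof.
move=> Fc; split=> [x|x e e0].
  by apply: bounded_linear_dsum => i; have [] := Fc i.
(* The successor keeps the denominator positive when I is empty. *)
pose e' := e / #|I|.+1%:R; have e'0 : 0 < e' by rewrite divr_gt0.
have : \forall y \near x, forall i v, `|F y v i - F x v i| <= e' * `|v|.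
  apply: (@filter_forall _ I (fun i y => forall v, `|F y v i - F x v i| <= e' * `|v|) (nbhs x)) => i.
  by have [_ /(_ x _ e'0)] := Fc i.
apply: filterS => y Fy v.
rewrite dsum_normE (le_trans (ler_sum _ (fun i _ => Fy i v)))//.
rewrite sumr_const -mulrnAl ler_wpM2r// /e' -mulr_natr mulrAC ler_pdivrMr//.
by rewrite ler_wpM2l ?(ltW e0)// ler_nat.
Qed.

End ContinuousFamilies.

(** * Optimal constants and powers of a distance at most 1 *)

Section Constants.
Context {R : realType}.

(** If b z > 0, the condition at z says that C is at least a z / b z, which passes to the infimum.
    If b z = 0, it does not depend on C, so any member of E settles it. *)
Lemma inf_constant (T : Type) (P : T -> Prop) (a b : T -> R) :
  (forall z, 0 <= b z) ->
  let E := [set C : R | 0 <= C /\ forall z, P z -> a z <= C * b z] in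
  E !=set0 -> E (inf E).
Proof.
move=> b0 E E0; have Elb : lbound E 0 by move=> C [].
split=> [|z Pz]; first exact: lb_le_inf.
have [bz0|bz] := eqVneq (b z) 0.
  by have [C [_ /(_ z Pz)]] := E0; rewrite bz0 !mulr0.
have bzp : 0 < b z by rewrite lt_def bz b0.
rewrite -ler_pdivrMr//; apply: lb_le_inf => // C [_ /(_ z Pz)].
by rewrite ler_pdivrMr.
Qed.

Lemma powR_le1 (d a b : R) : 0 <= d <= 1 -> 0 <= b -> b <= a -> d `^ a <= d `^ b.
Proof.
move=> /andP[d0 d1] b0 ba; move: d0; rewrite le_eqVlt => /predU1P[<-|d0].
  move: b0; rewrite le_eqVlt => /predU1P[<-|b0].
    by rewrite powRr0; have [->|a0] := eqVneq a 0; rewrite ?powRr0 ?powR0.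
  by rewrite !powR0// gt_eqF// (lt_le_trans b0).
by rewrite ger_powR// d0.
Qed.

Lemma powRM_le1 (d a b c : R) : 0 <= d <= 1 -> 0 <= a -> 0 <= b -> 0 <= c ->
  c <= a + b -> d `^ a * d `^ b <= d `^ c.
Proof.
move=> d01 a0 b0 c0 cab; have [d0 d1] := andP d01.
rewrite (le_trans _ (powR_le1 d01 c0 cab))//.
move: d0; rewrite le_eqVlt => /predU1P[<-|d0]; last first.
  by rewrite powRD// (gt_eqF d0) implybT.
have [->|aN0] := eqVneq a 0; first by rewrite powRr0 mul1r add0r.
by rewrite powR0// mul0r powR_ge0.
Qed.

End Constants.

(** * Skeletons *)

Section UnipotentInverse.
Context {R : realType} {S : abstract_space R}.
Context (g : forall b c : idx S, piece c -> piece b).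
Arguments g : clear implicits.
Hypothesis g_bounded : forall b c, bounded_linear (g b c).

Let low (v : graded_sum S) : graded_sum S :=
  fun b => \sum_(c | homog c < homog b) g b c (v c).

Let rank (b : idx S) := #|[set c : idx S | homog c < homog b]%SET|.

Let low_bounded : bounded_linear low.
Proof.
apply: bounded_linear_dsum => b; apply: bounded_linear_sum => c.
exact: (bounded_linear_comp (g_bounded b c)
  (bounded_linear_coord (@piece _ S) c)).
Qed.

Let rank_lt c b : homog c < homog b -> (rank c < rank b)%N.
Proof.
move=> cb; apply/proper_card/properP; split.
  by apply/fintype.subsetP => i; rewrite !inE => /lt_trans; apply.
by exists c; rewrite !inE // ltxx.
Qed.

Let rank_max b : (rank b < #|idx S|)%N.
Proof.
rewrite -cardsT; apply/proper_card/properP; split; first exact: finset.subsetT.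
by exists b; rewrite !inE// ltxx.
Qed.

(** Coordinate b of [low w] involves only coordinates of w of smaller rank, so n steps annihilate
    all ranks below n. The sequence is given by its recursion because two of them occur: the error
    of the iteration below and the difference of its consecutive terms. *)
Let low_nilpotent n (h : nat -> graded_sum S) :
  (forall k, h k.+1 = - low (h k)) ->
  forall b, (rank b < n)%N -> h n b = 0.
Proof.
move=> hS; elim: n => // n ih b bn; rewrite hS dsum_oppE /low big1 ?oppr0// => c cb.
rewrite ih ?(lin0 (bounded_linear_lin (g_bounded b c)))//.
by rewrite (leq_trans (rank_lt cb))// -ltnS.
Qed.

Lemma unipotent_inverse (G : graded_sum S -> graded_sum S) :
  (forall v b, G v b = v b + \sum_(c | homog c < homog b) g b c (v c)) ->
  exists H, [/\ bounded_linear H, cancel G H & cancel H G].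
Proof.
move=> GE; have {}GE v : G v = v + low v by apply: dsum_ext => b; rewrite GE.
have low_lin := bounded_linear_lin low_bounded.
(* The fixed-point iteration w - low _ for G v = w stabilizes after #|idx S|
   steps, low being nilpotent. *)
pose approx := fix approx n w := if n is m.+1 then w - low (approx m w) else 0.
have zero_at_card (h : nat -> graded_sum S) :
    (forall k, h k.+1 = - low (h k)) -> h #|idx S| = 0.
  by move=> hS; apply: dsum_ext => b; apply: low_nilpotent.
exists (approx #|idx S|); split.
- elim: #|idx S| => [|n ih] /=; first exact: bounded_linear0.
  apply: bounded_linearB; first exact: bounded_linear_id.
  exact: bounded_linear_comp.
- move=> v; apply/eqP; rewrite -subr_eq0; apply/eqP.
  apply: (zero_at_card (fun n => approx n (G v) - v)) => k /=.
  rewrite (linB low_lin) opprB; set a := approx k _.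
  by rewrite GE [v + _]addrC -!addrA; congr (_ + _); rewrite addrCA subrr addr0.
- move=> w; rewrite GE; apply/eqP; rewrite eq_sym -subr_eq;
  rewrite -subr_eq0; apply/eqP.
  apply: (zero_at_card (fun n => approx n.+1 w - approx n w)) => k /=.
  rewrite [in RHS](linB low_lin) [in RHS]opprB [in LHS]opprB.
  by rewrite addrC addrA addrNK.
Qed.

End UnipotentInverse.

Section Skeleton.
Context {R : realType} {S : abstract_space R}.
Context (G : plane R -> graded_sum S -> graded_sum S).
Hypothesis G_triangular : triangular G.

Lemma triangular_inverse x :
  exists H, [/\ bounded_linear H, cancel (G x) H & cancel H (G x)].
Proof.
have [g [gb GE]] := G_triangular.
exact: (unipotent_inverse (gb x) (GE x)).
Qed.

Lemma triangular_min x v b : (forall c : idx S, homog b <= homog c) -> G x v b = v b.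
Proof.
have [g [gb GE]] := G_triangular; move=> bmin.
by rewrite GE big_pred0 ?addr0// => c; apply/negbTE; rewrite -leNgt.
Qed.

(** With H the inverse of G x, one admissible coefficient family is V x composed with H and the
    inclusion of piece b; the existence of one family gives the properties of the chosen one. *)
Lemma reductionP (V : plane R -> graded_sum S -> R^o) :
  (forall x, bounded_linear (V x)) ->
  (forall x b, bounded_linear (@reduction _ _ G V x b)) /\
  (forall x v, V x v = \sum_b reduction G V x (G x v b)).
Proof.
move=> Vb; pose P (W : plane R -> forall b : idx S, piece b -> R^o) :=
  (forall x b, bounded_linear (W x b)) /\
  (forall x v, V x v = \sum_b W x b (G x v b)).
suff PE : exists W, P W by exact: (xgetPex _ PE).
have [H HP] := choice triangular_inverse.
exists (fun x b w => V x (H x (dsum_inj w))); split=> [x b|x v].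
  have [Hb _ _] := HP x; apply: (bounded_linear_comp (Vb x)).
  exact: (bounded_linear_comp Hb (bounded_linear_dsum_inj _ _)).
have [Hb GK _] := HP x.
rewrite -{1}[v]GK {1}[G x v]dsum_decomp (lin_sum (bounded_linear_lin Hb)).
by rewrite (lin_sum (bounded_linear_lin (Vb x))).
Qed.

Lemma increment_bound_seminorm a V : (exists C, increment_bound G a V C) ->
  increment_bound G a V (modelled_seminorm G a V).
Proof.
move=> VE.
have [] := @inf_constant R _ (fun z => pdist z.2 z.1.1 <= 1)
  (fun z : plane R * graded_sum S * plane R => `|V z.2 z.1.2 - V z.1.1 z.1.2|)
  (fun z => \sum_b pdist z.2 z.1.1 `^ (Num.max (a - homog b) 0) *
     `|G z.1.1 z.1.2 b|).
- by move=> z; apply: sumr_ge0 => b _; rewrite mulr_ge0// powR_ge0.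
- have [C [C0 VC]] := VE; exists C; split=> // -[[x v] y] /=; exact: VC.
rewrite (_ : [set _ | _] = [set C | increment_bound G a V C]).
  by move=> ? H; split=> // x y v xy; exact: (H (x, v, y)).
apply/seteqP; split=> C [C0 H]; split=> //.
  by move=> x y v xy; exact: (H (x, v, y)).
by move=> [[x v] y]; exact: H.
Qed.

Lemma size_bound_norm N br V : (exists C, size_bound N br G V C) ->
  size_bound N br G V (modelled_norm N br G V).
Proof.
move=> VE.
have [] := @inf_constant R _ (fun=> True)
  (fun z : plane R * graded_sum S => `|V z.1 z.2|)
  (fun z => \sum_b N `^ br b * `|G z.1 z.2 b|).
- by move=> z; apply: sumr_ge0 => b _; rewrite mulr_ge0// powR_ge0.
- by have [C [C0 VC]] := VE; exists C; split=> // -[x v] /=.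
rewrite (_ : [set _ | _] = [set C | size_bound N br G V C]).
  by move=> ? H; split=> // x v; exact: (H (x, v)).
apply/seteqP; split=> C [C0 H]; split=> //.
  by move=> x v; exact: (H (x, v)).
Qed.

Lemma skeleton_bound_norm : (exists C, skeleton_bound G C) ->
  skeleton_bound G (skeleton_norm G).
Proof.
move=> VE.
have [] := @inf_constant R _ (fun z => pdist z.2 z.1.1.1 <= 1)
  (fun z : plane R * idx S * graded_sum S * plane R =>
    `|G z.2 z.1.2 z.1.1.2 - G z.1.1.1 z.1.2 z.1.1.2|)
  (fun z => \sum_(c | homog c < homog z.1.1.2)
     pdist z.2 z.1.1.1 `^ (homog z.1.1.2 - homog c) * `|G z.1.1.1 z.1.2 c|).
- by move=> z; apply: sumr_ge0 => b _; rewrite mulr_ge0// powR_ge0.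
- have [C [C0 VC]] := VE; exists C; split=> // -[[[x b] v] y] /=; exact: VC.
rewrite (_ : [set _ | _] = [set C | skeleton_bound G C]).
  by move=> ? H; split=> // x y b v xy; exact: (H (x, b, v, y)).
apply/seteqP; split=> C [C0 H]; split=> //.
  by move=> x y b v xy; exact: (H (x, b, v, y)).
by move=> [[[x b] v] y]; exact: H.
Qed.

End Skeleton.

(** * Tensor products *)

Section TensorMaps.
Context {R : realType}.

(* A map s: X -> Y -> Z for which a bounded linear function on Z is determined
   by its values on the elements s u v. *)
Definition determining (X Y Z : normedModType R) (s : X -> Y -> Z) :=
  forall (W : normedModType R) (B B' : Z -> W),
    bounded_linear B -> bounded_linear B' ->
    (forall u v, B (s u v) = B' (s u v)) -> forall z, B z = B' z.

(** The difference of the two maps is Lipschitz and vanishes on finite sums of elementary tensors,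
    which are dense. *)
Lemma crossnorm_determining (X Y Z : normedModType R) (t : X -> Y -> Z) :
  crossnorm_completion t -> determining t.
Proof.
move=> [_ _ _ t_dense] W B B' Bb Bb' BB' z.
have Db := bounded_linearB Bb Bb'; have [C C0 DC] := bounded_linear_bound Db.
apply/eqP; rewrite -subr_eq0 -normr_le0; apply/ler_addgt0Pl => e e0.
have C1 : 0 < C + 1 by rewrite ltr_wpDl.
have : [set: Z] z by []; rewrite -t_dense => /(_ (ball z (e / (C + 1))))[].
  by apply: nbhsx_ballx; rewrite divr_gt0.
move=> z' [[n [u [v ->]]]]; rewrite -ball_normE /= => zz'.
set D := fun z => B z - B' z in Db DC *.
have Dz' : D (\sum_i t (u i) (v i)) = 0.
  rewrite (lin_sum (bounded_linear_lin Db)) big1// => i _.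
  by rewrite /D BB' subrr.
have Dz : D z = D (z - \sum_i t (u i) (v i)).
  by rewrite (linB (bounded_linear_lin Db)) Dz' subr0.
rewrite addr0 -[B z - B' z]/(D z) Dz (le_trans (DC _))//.
rewrite (@le_trans _ _ ((C + 1) * (e / (C + 1))))//.
  by rewrite ler_pM ?lerDl// ltW.
by rewrite mulrCA mulfV ?gt_eqF// mulr1.
Qed.

Lemma tensor_opP (X1 X2 X Y1 Y2 Y : normedModType R)
    (s : X1 -> X2 -> X) (t : Y1 -> Y2 -> Y)
    (A1 : X1 -> Y1) (A2 : X2 -> Y2) (B : X -> Y) : is_tensor_op s t A1 A2 B ->
  is_tensor_op s t A1 A2 (tensor_op s t A1 A2).
Proof. by move=> BP; apply: (xgetPex (fun=> 0)); exists B. Qed.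

(** This is how the chosen operators are computed: exhibit any bounded linear map with the right
    values on elementary tensors. *)
Lemma tensor_op_eq (X1 X2 X Y1 Y2 Y : normedModType R)
    (s : X1 -> X2 -> X) (t : Y1 -> Y2 -> Y)
    (A1 : X1 -> Y1) (A2 : X2 -> Y2) (B : X -> Y) : determining s ->
  is_tensor_op s t A1 A2 B -> forall w, tensor_op s t A1 A2 w = B w.
Proof.
move=> s_det BP; have [Tb TE] := tensor_opP BP; have [Bb BE] := BP.
by apply: s_det => // u v; rewrite TE BE.
Qed.

Lemma scalar_tensor (Y : completeNormedModType R) (Z : normedModType R)
    (t : R^o -> Y -> Z) : crossnorm_completion t ->
  exists psi : Z -> Y, [/\ linear psi, forall z, `|psi z| = `|z|
    & forall (a : R^o) w, psi (t a w) = (a : R) *: w].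
Proof.
(* w |-> t 1 w is an isometry with dense range, hence onto as Y is complete. *)
move=> [[t_linr t_linl] t_norm _ t_dense].
have tE (a : R^o) w : t a w = t 1 ((a : R) *: w).
  by rewrite (linZ (t_linr _)) -(linZ (t_linl _)); congr t; rewrite [RHS]mulr1.
have t1_norm w : `|t 1 w| = `|w| by rewrite t_norm normr1 mul1r.
have t1_dense z e : 0 < e -> exists w, `|z - t 1 w| < e.
  move=> e0; have : [set: Z] z by []; rewrite -t_dense => /(_ (ball z e))[].
    exact: nbhsx_ballx.
  move=> z' [[n [u [v ->]]]]; rewrite -ball_normE /= => zz'.
  exists (\sum_i (u i : R) *: v i); move: zz'; rewrite (lin_sum (t_linr _)).
  by under eq_bigr do rewrite tE.
have t1_surj z : exists w, t 1 w = z.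
  (* The filter of approximate preimages of z. It is Cauchy because [t 1] is an isometry, and its
     limit is a preimage. *)
  pose F := filter_from [set e : R | 0 < e] (fun e => [set w | `|z - t 1 w| < e]).
  have FF : ProperFilter F.
    apply: filter_from_proper => [|e e0]; last exact: t1_dense.
    apply: filter_from_filter => [|e e' e0 e'0]; first by exists 1 => /=.
    exists (Num.min e e'); first by rewrite /= lt_min; apply/andP.
    by move=> w /=; rewrite lt_min => /andP.
  have Fc : cauchy F.
    apply: cauchy_exP => e e0; have e20 : 0 < e / 2 by rewrite divr_gt0.
    have [w0 w0P] := t1_dense z _ e20.
    exists w0; exists (e / 2) => //= w wP; rewrite -ball_normE /=.
    rewrite -t1_norm (linB (t_linr _)) -(subrKA z) [e]splitr.
    by rewrite (le_lt_trans (ler_normD _ _))// addrC ltrD// distrC.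
  have /cvg_ex[l Fl] : cvg F by exact: cauchy_cvg.
  exists l.
  apply/eqP; rewrite -subr_eq0 -normr_le0; apply/ler_addgt0Pl => e e0.
  have e20 : 0 < e / 2 by rewrite divr_gt0.
  have Fe : F [set w | `|z - t 1 w| < e / 2] by exists (e / 2).
  have Fl' : F [set w | `|l - w| < e / 2].
    by apply: Fl; have := nbhsx_ballx l _ e20; rewrite -ball_normE.
  have [w [/= zw lw]] := filter_ex (filterI Fe Fl').
  rewrite addr0 -(subrKA (t 1 w)) -(linB (t_linr _)).
  rewrite (le_trans (ler_normD _ _))// t1_norm [e]splitr lerD// ltW//.
  by rewrite distrC.
have [psi psiP] := choice t1_surj.
have psi_norm z : `|psi z| = `|z| by rewrite -{2}(psiP z) t1_norm.
have t1_inj w w' : t 1 w = t 1 w' -> w = w'.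
  move=> /eqP; rewrite -subr_eq0 -(linB (t_linr _)) -normr_eq0 t1_norm.
  by rewrite normr_eq0 subr_eq0 => /eqP.
exists psi; split=> // [a z z'|a w]; apply: t1_inj.
  by rewrite t_linr !psiP.
by rewrite psiP -tE.
Qed.

End TensorMaps.

(** * Components of the product space *)

Section ProductSpace.
Context {R : realType} {Sp Sm : abstract_space R} (K : tensor_system Sp Sm).
Local Notation Z := (graded_sum (prod_space K)).

Lemma prod_space_ext (v w : Z) :
  (forall i j, component v i j = component w i j) -> v = w.
Proof.
move=> vw; apply: dsum_ext => b; apply: (@dsum_ext R) => -[[i j] e].
(* The pair (i, j) lives only in the piece of index homog i + homog j. After substituting this
   index, irrelevance of boolean proofs turns e into the proof used by [component]. *)
have eb : b = prod_idx K i j by apply: val_inj; exact/esym/eqP.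
by subst b; rewrite (bool_irrelevance e (eqxx _)); exact: vw.
Qed.

Lemma big_sig_val (T : finType) (P : pred T) (F : T -> R) :
  \sum_(x : {x | P x}) F (val x) = \sum_(x | P x) F x.
Proof. exact: (esym (big_sub P F)). Qed.

(** The pairs (i, j) are partitioned according to the value of homog i + homog j. *)
Lemma prod_space_sum (F : forall i j, tens K (Piece i) (Piece j) -> R) (v : Z) :
  \sum_b \sum_(p : {p : idx Sp * idx Sm | homog p.1 + homog p.2 == fsval b})
     F (val p).1 (val p).2 ((v b : prod_piece K b) p) =
  \sum_i \sum_j F i j (component v i j).
Proof.
rewrite pair_big/=.
rewrite (partition_big (fun p : idx Sp * idx Sm => prod_idx K p.1 p.2) xpredT)//=.
apply: eq_bigr => b _.
rewrite -[RHS](big_sig_val (fun p => homog p.1 + homog p.2 == fsval b)).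
apply: eq_bigr => -[[i j] e] _ /=.
have eb : b = prod_idx K i j by apply: val_inj; exact/esym/eqP.
by subst b; rewrite (bool_irrelevance e (eqxx _)).
Qed.

Lemma component_prod_pure u v i j : component (prod_pure (K := K) u v) i j =
  pure K (c := Piece i) (d := Piece j) (u i) (v j).
Proof. by []. Qed.

Lemma bounded_linear_component i j :
  bounded_linear (fun v : Z => component v i j).
Proof.
exact: (bounded_linear_comp
  (bounded_linear_coord (fun p : {p : idx Sp * idx Sm | homog p.1 + homog p.2 ==
    fsval (prod_idx K i j)} => tens K (Piece (val p).1) (Piece (val p).2))
    (exist _ (i, j) (eqxx _)))
  (bounded_linear_coord (@piece _ (prod_space K)) (prod_idx K i j))).
Qed.

(** Converts between the sums over A in the final estimates and the sums over pairs that tensor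
    products produce. *)
Lemma sum_norm_prod (c : idx (prod_space K) -> R) (v : Z) :
  \sum_b c b * `|v b| = \sum_i \sum_j c (prod_idx K i j) * `|component v i j|.
Proof.
rewrite -(prod_space_sum (fun i j w => c (prod_idx K i j) * `|w|)).
apply: eq_bigr => b _; rewrite dsum_normE mulr_sumr.
apply: eq_bigr => -[[i j] e] _ /=; congr (c _ * _).
by apply: val_inj; exact/esym/eqP.
Qed.

End ProductSpace.

(** * Operators and forms on the product, under the uniformity of the crossnorm *)

Section UniformCrossnorm.
Context {R : realType} {Sp Sm : abstract_space R} (K : tensor_system Sp Sm).
Hypothesis K_uniform : uniform_crossnorm K.
Local Notation Z := (graded_sum (prod_space K)).
Local Notation whole_tens := (tens K (whole Sp) (whole Sm)).
Local Notation ppure := (@prod_pure R Sp Sm K).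

(** The uniformity clauses concern the abstract tensor product of the two whole spaces, while
    skeletons and forms act on its graded version; f and h carry statements from one to the
    other. *)
Lemma whole_tens_iso : exists (f : whole_tens -> Z) (h : Z -> whole_tens),
  [/\ linear f, forall w, `|f w| = `|w|, linear h, forall v, `|h v| = `|v|
    & [/\ cancel f h, cancel h f & forall u v,
       f (pure K (c := whole Sp) (d := whole Sm) u v) = ppure u v]].
Proof.
have [_ [f [fl fn fs fp]] _ _] := K_uniform.
have f_inj w w' : f w = f w' -> w = w'.
  move=> /eqP; rewrite -subr_eq0 -(linB fl) -normr_eq0 fn.
  by rewrite normr_eq0 subr_eq0 => /eqP.
have [h hK] := choice fs.
exists f, h; split=> // [a u v|v|]; last split=> //.
- by apply: f_inj; rewrite hK fl !hK.
- by rewrite -fn hK.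
- by move=> w; apply: f_inj; rewrite hK.
Qed.

Lemma pure_determining c d : determining (pure K (c := c) (d := d)).
Proof. by have [Kc _ _ _] := K_uniform; apply: crossnorm_determining. Qed.

Lemma prod_pure_determining : determining ppure.
Proof.
have [f [h [fl fn hl hn [fK hK fp]]]] := whole_tens_iso.
have fb := bounded_linear_isometry fl fn.
move=> W B B' Bb Bb' BB' z; rewrite -[z]hK.
apply: (pure_determining (bounded_linear_comp Bb fb)
  (bounded_linear_comp Bb' fb)) => u v.
by rewrite fp; exact: BB'.
Qed.

(* psi identifies the completed tensor product tens K c d with Y isometrically,
   turning elementary tensors into the values of t. *)
Definition realizes (c : Defs.factor Sp) (d : Defs.factor Sm) (Y : normedModType R)
    (t : space_of c -> space_of d -> Y) (psi : tens K c d -> Y) :=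
  [/\ linear psi, forall z, `|psi z| = `|z|
    & forall u v, psi (pure K u v) = t u v].

Lemma realizes_pure c d : realizes (@pure R Sp Sm K c d) id.
Proof. by []. Qed.

Lemma realizes_prod_pure : exists psi,
  realizes (c := whole Sp) (d := whole Sm) ppure psi.
Proof. by have [f [h [fl fn _ _ [_ _ fp]]]] := whole_tens_iso; exists f. Qed.

Section Target.
Context {c : Defs.factor Sp} {d : Defs.factor Sm} {Y : normedModType R}.
Context {t : space_of c -> space_of d -> Y} {psi : tens K c d -> Y}.
Hypothesis t_psi : realizes t psi.
Local Notation top := (tensor_op ppure t).

Lemma realizes_linl v : linear (t^~ v).
Proof.
have [pl _ pE] := t_psi; have [Kc _ _ _] := K_uniform.
have [[_ pure_l] _ _ _] := Kc c d.
by move=> a u u'; rewrite -!pE pure_l pl.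
Qed.

Lemma realizes_linr u : linear (t u).
Proof.
have [pl _ pE] := t_psi; have [Kc _ _ _] := K_uniform.
have [[pure_r _] _ _ _] := Kc c d.
by move=> a v v'; rewrite -!pE pure_r pl.
Qed.

(** One M serves all pairs of operators; this yields the continuity in x of A(x) (x) B(x). *)
Lemma prod_tensor_op_bound : exists M : R, forall A1 A2,
  bounded_linear A1 -> bounded_linear A2 ->
  is_tensor_op ppure t A1 A2 (top A1 A2) /\
  forall a1 a2 : R, 0 <= a1 -> (forall u, `|A1 u| <= a1 * `|u|) ->
    0 <= a2 -> (forall v, `|A2 v| <= a2 * `|v|) ->
    forall w, `|top A1 A2 w| <= M * a1 * a2 * `|w|.
Proof.
have [pl pn pE] := t_psi.
have [f [h [fl fn hl hn [fK hK fp]]]] := whole_tens_iso.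
have [_ _ /(_ (whole Sp) c (whole Sm) d isT isT)[M MP] _] := K_uniform.
exists M => A1 A2 A1b A2b; have [B [Bb BE] BM] := MP A1 A2 A1b A2b.
have BP : is_tensor_op ppure t A1 A2 (fun w => psi (B (h w))).
  split=> [|u v]; last by rewrite -fp fK BE pE.
  apply: (bounded_linear_comp (bounded_linear_isometry pl pn)).
  exact: (bounded_linear_comp Bb (bounded_linear_isometry hl hn)).
split; first exact: tensor_opP BP.
move=> a1 a2 a10 A1a a20 A2a w.
by rewrite (tensor_op_eq prod_pure_determining BP) pn -(hn w) BM.
Qed.

Lemma prod_tensor_opP A1 A2 : bounded_linear A1 -> bounded_linear A2 ->
  is_tensor_op ppure t A1 A2 (top A1 A2).
Proof.
by move=> A1b A2b; have [M /(_ A1 A2 A1b A2b)[]] := prod_tensor_op_bound.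
Qed.

Lemma tensor_opBl A A' B w :
  bounded_linear A -> bounded_linear A' -> bounded_linear B ->
  top (fun u => A u - A' u) B w = top A B w - top A' B w.
Proof.
move=> Ab Ab' Bb; move: w; refine (tensor_op_eq prod_pure_determining _).
have [Tb TE] := prod_tensor_opP Ab Bb; have [Tb' TE'] := prod_tensor_opP Ab' Bb.
split=> [|u v]; first exact: bounded_linearB.
by rewrite TE TE' (linB (realizes_linl _)).
Qed.

Lemma tensor_opBr A B B' w :
  bounded_linear A -> bounded_linear B -> bounded_linear B' ->
  top A (fun v => B v - B' v) w = top A B w - top A B' w.
Proof.
move=> Ab Bb Bb'; move: w; refine (tensor_op_eq prod_pure_determining _).
have [Tb TE] := prod_tensor_opP Ab Bb; have [Tb' TE'] := prod_tensor_opP Ab Bb'.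
split=> [|u v]; first exact: bounded_linearB.
by rewrite TE TE' (linB (realizes_linr _)).
Qed.

Lemma tensor_opZl (a : R) A B w : bounded_linear A -> bounded_linear B ->
  top (fun u => a *: A u) B w = a *: top A B w.
Proof.
move=> Ab Bb; move: w; refine (tensor_op_eq prod_pure_determining _).
have [Tb TE] := prod_tensor_opP Ab Bb.
split=> [|u v]; first exact: bounded_linearZ.
by rewrite TE (linZ (realizes_linl _)).
Qed.

Lemma C0_tensor_op (A : plane R -> graded_sum Sp -> space_of c)
    (B : plane R -> graded_sum Sm -> space_of d) :
  C0_op A -> C0_op B -> C0_op (fun x => top (A x) (B x)).
Proof.
move=> [Ab Ac] [Bb Bc]; split=> [x|x e e0].
  by have [] := prod_tensor_opP (Ab x) (Bb x).
have [M MP] := prod_tensor_op_bound.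
have [a a0 Aa] := bounded_linear_bound (Ab x).
have [b b0 Bb'] := bounded_linear_bound (Bb x).
(* If both increments are at most r <= 1, then B y has norm at most b + 1, and the two terms of the
   splitting below add up to at most |M| r (b + 1 + a) <= r D <= e. *)
pose D := `|M| * (b + 1 + a) + 1.
have D0 : 0 < D by rewrite ltr_wpDl// mulr_ge0// !addr_ge0.
pose r := Num.min 1 (e / D).
have r0 : 0 < r by rewrite lt_min ltr01 divr_gt0.
apply: filterS2 (Ac x r r0) (Bc x r r0) => y Ay By w.
have AB0 : bounded_linear (fun u => A y u - A x u) by exact: bounded_linearB.
have BB0 : bounded_linear (fun u => B y u - B x u) by exact: bounded_linearB.
have -> : top (A y) (B y) w - top (A x) (B x) w =
    top (fun u => A y u - A x u) (B y) w + top (A x) (fun v => B y v - B x v) w.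
  by rewrite tensor_opBl// tensor_opBr// addrA addrNK.
have Byb v : `|B y v| <= (b + 1) * `|v|.
  rewrite -[B y v](subrK (B x v)) (le_trans (ler_normD _ _))// addrC mulrDl.
  by rewrite lerD// (le_trans (By v))// ler_wpM2r// ge_min lexx.
have le_M m : 0 <= m -> M * m <= `|M| * m by move=> m0; rewrite ler_wpM2r// ler_norm.
have [_ M1] := MP _ _ AB0 (Bb y); have [_ M2] := MP _ _ (Ab x) BB0.
rewrite (le_trans (ler_normD _ _))//.
have r0' := ltW r0; have b10 : 0 <= b + 1 by rewrite addr_ge0.
rewrite (le_trans (lerD (M1 _ _ r0' Ay b10 Byb w) (M2 _ _ a0 Aa r0' By w)))//.
rewrite -mulrDl ler_wpM2r//.
rewrite -!mulrA -mulrDr (mulrC a) -mulrDr mulrCA.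
rewrite (@le_trans _ _ (r * D))//.
  rewrite ler_wpM2l// /D (le_trans (le_M _ _)) ?addr_ge0//.
  by rewrite lerDl.
by rewrite -ler_pdivlMr// ge_min lexx orbT.
Qed.

(** The domination clause carried over to the graded product and to the target of t. The dominating
    operators take values in the whole graded sums, which are graded as that clause demands. *)
Lemma tensor_op_domination A1 A2 B1 B2 :
  bounded_linear A1 -> bounded_linear A2 ->
  bounded_linear B1 -> bounded_linear B2 ->
  (forall u, `|A1 u| <= `|B1 u : graded_sum Sp|) ->
  (forall v, `|A2 v| <= `|B2 v : graded_sum Sm|) ->
  forall w, `|top A1 A2 w| <= `|tensor_op ppure ppure B1 B2 w|.
Proof.
move=> A1b A2b B1b B2b AB1 AB2 w.
have [pl pn pE] := t_psi.
have [f [h [fl fn hl hn [fK hK fp]]]] := whole_tens_iso.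
have [_ _ Kex Kdom] := K_uniform.
have [_ /(_ A1 A2 A1b A2b)[A AP _]] := Kex (whole Sp) c (whole Sm) d isT isT.
have [_ /(_ B1 B2 B1b B2b)[B BP _]] :=
  Kex (whole Sp) (whole Sp) (whole Sm) (whole Sm) isT isT.
have hb := bounded_linear_isometry hl hn.
have := Kdom (whole Sp) c (whole Sp) (whole Sm) d (whole Sm) isT isT isT isT
  A1 A2 B1 B2 A1b A2b B1b B2b AB1 AB2 (h w).
rewrite (tensor_op_eq (@pure_determining _ _) AP).
rewrite (tensor_op_eq (@pure_determining _ _) BP).
have [Ab AE] := AP; have [Bb BE] := BP.
rewrite (@tensor_op_eq _ _ _ _ _ _ _ ppure t A1 A2 (fun w => psi (A (h w))))//.
- rewrite (@tensor_op_eq _ _ _ _ _ _ _ ppure ppure B1 B2 (fun w => f (B (h w)))).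
  + by rewrite pn fn.
  + exact: prod_pure_determining.
  + split=> [|u v]; last by rewrite -fp fK BE fp.
    apply: (bounded_linear_comp (bounded_linear_isometry fl fn)).
    exact: bounded_linear_comp.
- exact: prod_pure_determining.
- split=> [|u v]; last by rewrite -fp fK AE pE.
  apply: (bounded_linear_comp (bounded_linear_isometry pl pn)).
  exact: bounded_linear_comp.
Qed.

End Target.

Lemma prod_operatorP G1 G2 : bounded_linear G1 -> bounded_linear G2 ->
  is_tensor_op ppure ppure G1 G2 (tensor_op ppure ppure G1 G2).
Proof. by have [psi /prod_tensor_opP] := realizes_prod_pure; apply. Qed.

Lemma component_tensor_op G1 G2 i j w :
  bounded_linear G1 -> bounded_linear G2 ->
  component (tensor_op ppure ppure G1 G2 w) i j =
  tensor_op ppure (pure K (c := Piece i) (d := Piece j))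
    (fun u => G1 u i) (fun v => G2 v j) w.
Proof.
move=> G1b G2b; have [Gb GE] := prod_operatorP G1b G2b; apply/esym.
move: w; refine (tensor_op_eq prod_pure_determining _); split=> [|u v].
  exact: (bounded_linear_comp (bounded_linear_component K i j) Gb).
by rewrite GE component_prod_pure.
Qed.

Lemma tensor_op_weighted (c : Defs.factor Sp) (d : Defs.factor Sm)
    (Y : normedModType R) (t : space_of c -> space_of d -> Y) psi
    G1 G2 A1 A2 (a : idx Sp -> R) (b : idx Sm -> R) :
  realizes t psi ->
  bounded_linear G1 -> bounded_linear G2 ->
  bounded_linear A1 -> bounded_linear A2 ->
  (forall i, 0 <= a i) -> (forall j, 0 <= b j) ->
  (forall u, `|A1 u| <= \sum_i a i * `|(G1 u : graded_sum Sp) i|) ->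
  (forall v, `|A2 v| <= \sum_j b j * `|(G2 v : graded_sum Sm) j|) ->
  forall w, `|tensor_op ppure t A1 A2 w| <= \sum_i \sum_j a i * b j *
    `|component (tensor_op ppure ppure G1 G2 w) i j|.
Proof.
move=> t_psi G1b G2b A1b A2b a0 b0 Aa Ab w.
(* In the sum norm, the norms of B1 u and B2 v are exactly the right-hand sides of the assumed
   bounds. *)
pose B1 u : graded_sum Sp := fun i => a i *: G1 u i.
pose B2 v : graded_sum Sm := fun j => b j *: G2 v j.
have B1b : bounded_linear B1.
  apply: bounded_linear_dsum => i; apply: bounded_linearZ.
  exact: (bounded_linear_comp (bounded_linear_coord (@piece _ Sp) i) G1b).
have B2b : bounded_linear B2.
  apply: bounded_linear_dsum => j; apply: bounded_linearZ.
  exact: (bounded_linear_comp (bounded_linear_coord (@piece _ Sm) j) G2b).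
rewrite (le_trans (tensor_op_domination t_psi A1b A2b B1b B2b _ _ w))//.
- move=> u; rewrite dsum_normE (le_trans (Aa u))//; apply: ler_sum => i _.
  by rewrite normrZ ger0_norm.
- move=> v; rewrite dsum_normE (le_trans (Ab v))//; apply: ler_sum => j _.
  by rewrite normrZ ger0_norm.
have [Gb GE] := prod_operatorP G1b G2b; have [Bb BE] := prod_operatorP B1b B2b.
have compE i j : component (tensor_op ppure ppure B1 B2 w) i j =
    (a i * b j) *: component (tensor_op ppure ppure G1 G2 w) i j.
  have cb := bounded_linear_component K i j.
  apply: (prod_pure_determining (bounded_linear_comp cb Bb)
    (bounded_linearZ (a i * b j) (bounded_linear_comp cb Gb))) => u v.
  rewrite BE GE !component_prod_pure /B1 /B2.
  have [Kc _ _ _] := K_uniform.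
  have [[pure_r pure_l] _ _ _] := Kc (Piece i) (Piece j).
  by rewrite (linZ (pure_l _)) (linZ (pure_r _)) scalerA.
rewrite dsum_normE; under eq_bigr do rewrite -[Num.norm _]mul1r.
rewrite (sum_norm_prod (fun=> 1)); apply: ler_sum => i _; apply: ler_sum => j _.
by rewrite mul1r compE normrZ ger0_norm// mulr_ge0.
Qed.

End UniformCrossnorm.

(** * The product skeleton *)

Section ProductSkeleton.
Context {R : realType} {Sp Sm : abstract_space R} (K : tensor_system Sp Sm).
Hypothesis K_uniform : uniform_crossnorm K.
Context (Gp : plane R -> graded_sum Sp -> graded_sum Sp).
Context (Gm : plane R -> graded_sum Sm -> graded_sum Sm).
Hypotheses (Gp_skel : is_skeleton Gp) (Gm_skel : is_skeleton Gm).
Local Notation Z := (graded_sum (prod_space K)).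
Local Notation ppure := (@prod_pure R Sp Sm K).
Local Notation G := (prod_skeleton (K := K) Gp Gm).

Let Gp_bounded x : bounded_linear (Gp x). Proof. by have [[]] := Gp_skel. Qed.
Let Gm_bounded x : bounded_linear (Gm x). Proof. by have [[]] := Gm_skel. Qed.

Lemma C0_prod_skeleton : C0_op G.
Proof.
have [Gpc _ _] := Gp_skel; have [Gmc _ _] := Gm_skel.
have [psi psiP] := realizes_prod_pure K_uniform.
exact: (C0_tensor_op K_uniform psiP Gpc Gmc).
Qed.

Lemma prod_skeleton_bounded x : bounded_linear (G x).
Proof. by have [] := C0_prod_skeleton. Qed.

Lemma prod_skeleton_pure x u v : G x (ppure u v) = ppure (Gp x u) (Gm x v).
Proof.
have [_ GE] := prod_operatorP K_uniform (Gp_bounded x) (Gm_bounded x).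
exact: GE.
Qed.

Local Notation pieces b := (fun p : {p : idx Sp * idx Sm |
  homog p.1 + homog p.2 == fsval b} => tens K (Piece (val p).1) (Piece (val p).2)).

Definition prod_inj i j (z : tens K (Piece i) (Piece j)) : Z :=
  @dsum_inj _ _ (@piece _ (prod_space K)) (prod_idx K i j)
    (@dsum_inj _ _ (pieces (prod_idx K i j)) (exist _ (i, j) (eqxx _)) z).

Lemma bounded_linear_prod_inj i j : bounded_linear (@prod_inj i j).
Proof.
exact: (bounded_linear_comp
  (bounded_linear_dsum_inj (@piece _ (prod_space K)) (prod_idx K i j))
  (bounded_linear_dsum_inj (pieces (prod_idx K i j)) (exist _ (i, j) (eqxx _)))).
Qed.

Lemma component_inj i j (z : tens K (Piece i) (Piece j)) :
  component (prod_inj z) i j = z.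
Proof. by rewrite /component /prod_inj !dsum_injE. Qed.

Lemma component_inj_neq i j i' j' (z : tens K (Piece i) (Piece j)) :
  (i, j) != (i', j') -> component (prod_inj z) i' j' = 0.
Proof.
(* The index is generalized to b so that it can be replaced by [prod_idx K i j] when the two
   coincide; two different pairs may share a homogeneity. *)
move=> ij; suff inj0 b (p : {p : idx Sp * idx Sm | homog p.1 + homog p.2 == fsval b}) :
    (i, j) != val p -> ((prod_inj z : Z) b : prod_piece K b) p = 0.
  exact: (inj0 (prod_idx K i' j') (exist _ (i', j') (eqxx _)) ij).
rewrite /prod_inj; have [e|e] := eqVneq (prod_idx K i j) b.
  by subst b => {}ij; rewrite dsum_injE dsum_inj_neq.
by rewrite dsum_inj_neq.
Qed.

Lemma prod_decomp (v : Z) : v = \sum_i \sum_j prod_inj (component v i j).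
Proof.
apply: prod_space_ext => i j.
have cb := bounded_linear_component K i j.
rewrite (lin_sum (bounded_linear_lin cb)) (bigD1 i)//=.
rewrite (lin_sum (bounded_linear_lin cb)) (bigD1 j)//= component_inj.
rewrite !big1 ?addr0// => [i' i'i|j' j'j]; last first.
  by rewrite component_inj_neq// xpair_eqE (negPf j'j) andbF.
rewrite (lin_sum (bounded_linear_lin cb)) big1// => j' _.
by rewrite component_inj_neq// xpair_eqE (negPf i'i).
Qed.

Lemma prod_inj_pure i j (u : piece i) (v : piece j) :
  prod_inj (pure K (c := Piece i) (d := Piece j) u v) =
  ppure (dsum_inj u) (dsum_inj v).
Proof.
have [Kc _ _ _] := K_uniform.
apply: prod_space_ext => i' j'; rewrite component_prod_pure.
have [[pure_r pure_l] _ _ _] := Kc (Piece i') (Piece j').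
have [ii'|ii'] := eqVneq i i'; last first.
  rewrite component_inj_neq ?xpair_eqE ?(negPf ii')//.
  by rewrite [dsum_inj u _]dsum_inj_neq// (lin0 (pure_l _)).
have [jj'|jj'] := eqVneq j j'; last first.
  rewrite component_inj_neq ?xpair_eqE ?(negPf jj') ?andbF//.
  by rewrite [dsum_inj v _]dsum_inj_neq// (lin0 (pure_r _)).
by subst i' j'; rewrite component_inj !dsum_injE.
Qed.

(** The corrections to component k come from homogeneities strictly below that of k, hence below
    that of i, where an element of piece i has no entry. *)
Lemma triangular_inj (S : abstract_space R)
    (H : plane R -> graded_sum S -> graded_sum S) x (i k : idx S) (u : piece i) :
  triangular H -> homog k <= homog i ->
  H x (@dsum_inj _ _ (@piece _ S) i u) k = @dsum_inj _ _ (@piece _ S) i u k.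
Proof.
move=> [h [hb HE]] ki; rewrite HE big1 ?addr0// => l lk.
rewrite dsum_inj_neq ?(lin0 (bounded_linear_lin (hb _ _ _)))//.
by apply: contraTneq lk => <-; rewrite -leNgt.
Qed.

(** By density z is elementary. If homog i <= homog i' and homog j <= homog j', both factors are
    unchanged by triangularity. Otherwise one of these fails, the other is strict by the assumption
    on the sums, and the corresponding factor is zero on both sides. *)
Lemma component_prod_inj x i j i' j' (z : tens K (Piece i') (Piece j')) :
  homog i + homog j <= homog i' + homog j' ->
  component (G x (prod_inj z)) i j = component (prod_inj z) i j.
Proof.
move=> ij; have [_ Gpt _] := Gp_skel; have [_ Gmt _] := Gm_skel.
have cb := bounded_linear_component K i j.
have ib := @bounded_linear_prod_inj i' j'.
move: z; apply: (pure_determining K_uniform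
  (bounded_linear_comp cb (bounded_linear_comp (prod_skeleton_bounded x) ib))
  (bounded_linear_comp cb ib)) => u v.
rewrite /= prod_inj_pure prod_skeleton_pure !component_prod_pure.
have [Kc _ _ _] := K_uniform.
have [[pure_r pure_l] _ _ _] := Kc (Piece i) (Piece j).
have [ii'|ii'] := leP (homog i) (homog i').
  have [jj'|jj'] := leP (homog j) (homog j').
    by rewrite !triangular_inj.
  have {}ii' : homog i < homog i'.
    by rewrite -(ltrD2r (homog j')) (lt_le_trans _ ij)// ltrD2l.
  rewrite (triangular_inj x u Gpt (ltW ii')) dsum_inj_neq ?(lin0 (pure_l _))//.
  by apply: contraTneq ii' => ->; rewrite ltxx.
have jj' : homog j < homog j'.
  by rewrite -(ltrD2l (homog i')) (lt_le_trans _ ij)// ltrD2r.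
rewrite (triangular_inj x v Gmt (ltW jj')) [dsum_inj v _]dsum_inj_neq ?(lin0 (pure_r _))//.
by apply: contraTneq jj' => ->; rewrite ltxx.
Qed.

Lemma component_prod_skeleton x (v : Z) i j :
  (forall k l, homog k + homog l < homog i + homog j -> component v k l = 0) ->
  component (G x v) i j = component v i j.
Proof.
move=> v0; have cb := bounded_linear_lin (bounded_linear_component K i j).
have Gl := bounded_linear_lin (prod_skeleton_bounded x).
rewrite {1}[v]prod_decomp [in RHS](prod_decomp v).
rewrite (lin_sum Gl) !(lin_sum cb); apply: eq_bigr => k _.
rewrite (lin_sum Gl) !(lin_sum cb); apply: eq_bigr => l _.
have [kl|kl] := leP (homog i + homog j) (homog k + homog l).
  exact: component_prod_inj.
rewrite v0// (lin0 (bounded_linear_lin (@bounded_linear_prod_inj k l))).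
by rewrite (lin0 Gl).
Qed.

Lemma prod_skeleton_triangular : triangular G.
Proof.
exists (fun x b c (w : piece c) =>
  (G x (@dsum_inj _ _ (@piece _ (prod_space K)) c w) : Z) b); split=> [x b c|x v b].
  exact: (bounded_linear_comp (bounded_linear_coord (@piece _ (prod_space K)) b)
    (bounded_linear_comp (prod_skeleton_bounded x)
      (bounded_linear_dsum_inj (@piece _ (prod_space K)) c))).
have Gl := bounded_linear_lin (prod_skeleton_bounded x).
rewrite {1}[v](@dsum_decomp _ _ (@piece _ (prod_space K))) (lin_sum Gl) dsum_sumE.
(* The pieces c with homog c < homog b give the off-diagonal terms. All others together must give v
   b, since G x leaves component b of an element of such a piece unchanged. *)
rewrite (bigID (fun c => homog c < homog b))/= addrC; congr (_ + _).
rewrite [v in RHS](@dsum_decomp _ _ (@piece _ (prod_space K))) dsum_sumE.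
rewrite [RHS](bigID (fun c => homog c < homog b))/=.
rewrite [X in _ = X + _]big1 ?add0r; last first.
  by move=> c cb; rewrite dsum_inj_neq//; apply: contraTneq cb => ->; rewrite ltxx.
apply: eq_bigr => c; rewrite -leNgt => bc.
apply: (@dsum_ext R) => -[[i j] e].
have eb : b = prod_idx K i j by apply: val_inj; exact/esym/eqP.
subst b; rewrite (bool_irrelevance e (eqxx _)).
apply: component_prod_skeleton => k l kl.
rewrite /component dsum_inj_neq//.
by apply: contraTneq bc => ->; rewrite -ltNge.
Qed.

(** Once some constant is known, [skeleton_norm G] is itself admissible and can enter the bound for
    the extension. *)
Lemma prod_skeleton_boundP : exists C, skeleton_bound G C.
Proof.
have [_ _ [Cp [Cp0 GpP]]] := Gp_skel; have [_ _ [Cm [Cm0 GmP]]] := Gm_skel.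
(* The increment of a component splits into (increment of Gp) (x) Gm(y) and Gp(x) (x) (increment of
   Gm). Writing Gm(y) as Gm(x) plus its increment, the first gives Cp + Cp Cm, the second Cm. The
   number of pairs bounds the number of components in one piece. *)
pose C := Cp + Cp * Cm + Cm.
have C0 : 0 <= C by rewrite !addr_ge0// mulr_ge0.
exists (#|{: idx Sp * idx Sm}|%:R * C); split=> [|x y b v dxy]; first exact: mulr_ge0.
set d := pdist y x in dxy *.
have d0 : 0 <= d by rewrite addr_ge0// sqrtr_ge0.
set Sb := \sum_(c | _) _.
suff compP i j : homog i + homog j = homog b ->
    `|component (G y v) i j - component (G x v) i j| <= C * Sb.
  rewrite dsum_normE.
  apply: (@le_trans _ _ (\sum_(p : {p : idx Sp * idx Sm |
      homog p.1 + homog p.2 == fsval b}) C * Sb)).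
    apply: ler_sum => -[[i j] e] _.
    have eb : b = prod_idx K i j by apply: val_inj; exact/esym/eqP.
    move: (compP i j (eqP e)); subst b.
    by rewrite (bool_irrelevance e (eqxx _)).
  rewrite sumr_const -[leLHS]mulr_natl -mulrA ler_wpM2r ?ler_nat//.
    by rewrite mulr_ge0//; apply: sumr_ge0 => c _; rewrite mulr_ge0// powR_ge0.
  by rewrite card_sig max_card.
move=> ijb.
(* The restricted sums of the skeleton bounds become sums over all indices with weights that vanish
   elsewhere, the form that [tensor_op_weighted] takes. The claims [ga1], [ga2], [ga3] below compare
   the products of weights with the weight [ga] of the product. *)
pose al (k : idx Sp) := if homog k < homog i then d `^ (homog i - homog k) else 0.
pose be (l : idx Sm) := if homog l < homog j then d `^ (homog j - homog l) else 0.
pose ga c := if c < homog b then d `^ (homog b - c) else 0.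
have al0 k : 0 <= al k by rewrite /al; case: ifP; rewrite ?powR_ge0.
have be0 k : 0 <= be k by rewrite /be; case: ifP; rewrite ?powR_ge0.
have ga0 k : 0 <= ga k by rewrite /ga; case: ifP; rewrite ?powR_ge0.
have GpiB z : bounded_linear (fun u => Gp z u i).
  exact: (bounded_linear_comp (bounded_linear_coord (@piece _ Sp) i)).
have GmjB z : bounded_linear (fun u => Gm z u j).
  exact: (bounded_linear_comp (bounded_linear_coord (@piece _ Sm) j)).
have DpP u : `|Gp y u i - Gp x u i| <= \sum_k (Cp * al k) * `|Gp x u k|.
  rewrite (le_trans (GpP x y i u dxy))// mulr_sumr big_mkcond/=.
  apply: ler_sum => k _; rewrite /al; case: ifP; rewrite ?mulrA// => _.
  by rewrite mulr0 mul0r.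
have DmP u : `|Gm y u j - Gm x u j| <= \sum_l (Cm * be l) * `|Gm x u l|.
  rewrite (le_trans (GmP x y j u dxy))// mulr_sumr big_mkcond/=.
  apply: ler_sum => l _; rewrite /be; case: ifP; rewrite ?mulrA// => _.
  by rewrite mulr0 mul0r.
have SpP u : `|Gp x u i| <= \sum_k (k == i)%:R * `|Gp x u k|.
  by rewrite (bigD1 i)//= eqxx mul1r lerDl sumr_ge0// => k _; rewrite mulr_ge0.
have SmP u : `|Gm y u j| <= \sum_l ((l == j)%:R + Cm * be l) * `|Gm x u l|.
  rewrite -[Gm y u j](subrK (Gm x u j)) addrC (le_trans (ler_normD _ _))//.
  under eq_bigr do rewrite mulrDl.
  rewrite big_split/= lerD//.
  by rewrite (bigD1 j)//= eqxx mul1r lerDl sumr_ge0// => k _; rewrite mulr_ge0.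
have cE z : component (G z v) i j = tensor_op ppure
    (pure K (c := Piece i) (d := Piece j)) (fun u => Gp z u i) (fun u => Gm z u j) v.
  exact: component_tensor_op.
rewrite !cE.
have PP := @realizes_pure _ _ _ K (Piece i) (Piece j).
set T := tensor_op ppure _.
have -> : T (fun u => Gp y u i) (fun u => Gm y u j) v -
          T (fun u => Gp x u i) (fun u => Gm x u j) v =
    T (fun u => Gp y u i - Gp x u i) (fun u => Gm y u j) v +
    T (fun u => Gp x u i) (fun u => Gm y u j - Gm x u j) v.
  rewrite /T (tensor_opBl K_uniform PP)// (tensor_opBr K_uniform PP)//.
  by rewrite addrA subrK.
have GpDB : bounded_linear (fun u => Gp y u i - Gp x u i) by exact: bounded_linearB.
have GmDB : bounded_linear (fun u => Gm y u j - Gm x u j) by exact: bounded_linearB.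
have T1 := tensor_op_weighted K_uniform PP (Gp_bounded x) (Gm_bounded x) GpDB (GmjB y)
  (fun k => mulr_ge0 Cp0 (al0 k))
  (fun l => addr_ge0 (ler0n _ _) (mulr_ge0 Cm0 (be0 l))) DpP SmP v.
have T2 := tensor_op_weighted K_uniform PP (Gp_bounded x) (Gm_bounded x) (GpiB x) GmDB
  (fun k => ler0n _ _) (fun l => mulr_ge0 Cm0 (be0 l)) SpP DmP v.
rewrite (le_trans (ler_normD _ _))// (le_trans (lerD T1 T2))//.
have -> : Sb = \sum_k \sum_l ga (homog k + homog l) * `|component (G x v) k l|.
  rewrite -(sum_norm_prod (fun c => ga (homog c))) /Sb big_mkcond/=.
  by apply: eq_bigr => c _; rewrite /ga; case: ifP; rewrite ?mul0r.
rewrite -big_split mulr_sumr; apply: ler_sum => k _ /=.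
rewrite -big_split mulr_sumr; apply: ler_sum => l _ /=.
rewrite -mulrDl mulrA ler_wpM2r//.
have ga1 : al k * (l == j)%:R <= ga (homog k + homog l).
  have [->|_] := eqVneq l j; rewrite ?mulr0// mulr1 /al /ga -ijb ltrD2r.
  by case: ifP => // _; rewrite opprD addrACA subrr addr0.
have ga2 : (k == i)%:R * be l <= ga (homog k + homog l).
  have [->|_] := eqVneq k i; rewrite ?mul0r// mul1r /be /ga -ijb ltrD2l.
  by case: ifP => // _; rewrite opprD addrACA subrr add0r.
have ga3 : al k * be l <= ga (homog k + homog l).
  rewrite /al /be; case: ifP => ki; rewrite ?mul0r//.
  case: ifP => lj; rewrite ?mulr0// /ga -ijb ltrD// opprD addrACA.
  have ki0 := ltW ki; have lj0 := ltW lj; rewrite -subr_ge0 in ki0; rewrite -subr_ge0 in lj0.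
  by rewrite powRM_le1 ?d0// addr_ge0.
have h1 := ler_wpM2l Cp0 ga1; have h2 := ler_wpM2l Cm0 ga2.
have h3 := ler_wpM2l (mulr_ge0 Cp0 Cm0) ga3.
rewrite /C; lra.
Qed.

End ProductSkeleton.

(** * The positive part *)

Section Homogeneities.
Context {R : realType} (S : abstract_space R).

Let homog_bound (i : idx S) : `|homog i| <= \sum_(j : idx S) `|homog j|.
Proof. by rewrite (bigD1 i)//= lerDl sumr_ge0. Qed.

Lemma min_homog_le (i : idx S) : min_homog S <= homog i.
Proof.
apply: ge_inf; last by exists i.
exists (- \sum_(j : idx S) `|homog j|) => _ [j _ <-]; rewrite lerNl.
by rewrite (le_trans (ler_norm _))// normrN.
Qed.

Lemma max_homog_ge (i : idx S) : homog i <= max_homog S.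
Proof.
apply: ub_le_sup; last by exists i.
by exists (\sum_(j : idx S) `|homog j|) => _ [j _ <-]; rewrite (le_trans (ler_norm _)).
Qed.

(** The hypothesis supplies an index, because the supremum of the empty set is 0 by convention. *)
Lemma min_homog_le_max : max_homog S < 0 -> min_homog S <= max_homog S.
Proof.
move=> S0; have [i _|S_empty] := pickP (@predT (idx S)).
  exact: le_trans (min_homog_le i) (max_homog_ge i).
move: S0; rewrite /max_homog (_ : range _ = set0) ?sup0 ?ltxx//.
by rewrite -subset0 => r [i _ _]; have := S_empty i.
Qed.

End Homogeneities.

Lemma big_option (V : nmodType) (I : finType) (P : pred (option I))
    (F : option I -> V) :
  \sum_(o | P o) F o = (if P None then F None else 0) + \sum_(i | P (Some i)) F (Some i).
Proof.
rewrite big_mkcond (bigD1 None)//=; congr (_ + _).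
rewrite (reindex_omap Some id) => [|[]//].
by rewrite [RHS]big_mkcond; apply: eq_bigl => i; rewrite eqxx.
Qed.

Lemma ge_inf_range (R : realType) (I : finType) (f : I -> R) i : inf (range f) <= f i.
Proof.
apply: ge_inf; last by exists i.
exists (- \sum_j `|f j|) => _ [j _ <-]; rewrite lerNl.
by rewrite (le_trans (ler_norm _))// normrN (bigD1 j)//= lerDl sumr_ge0.
Qed.

(** * The parabolic distance and Hoelder functions *)

Section ParabolicDistance.
Context {R : realType}.
Implicit Types x y : plane R.

Lemma pdist_ge0 x y : 0 <= pdist x y.
Proof. by rewrite addr_ge0// sqrtr_ge0. Qed.

Lemma pdist_gt0 x y : x != y -> 0 < pdist x y.
Proof.
apply: contra_neqT; rewrite -leNgt => xy; have [x1 x2] : x.1 - y.1 = 0 /\ x.2 - y.2 = 0.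
  have /eqP : pdist x y = 0 by apply/eqP; rewrite eq_le xy pdist_ge0.
  rewrite paddr_eq0 ?sqrtr_ge0// normr_eq0 sqrtr_eq0 normr_le0.
  by move=> /andP[/eqP-> /eqP->].
by rewrite [x]surjective_pairing [y]surjective_pairing (subr0_eq x1) (subr0_eq x2).
Qed.

Lemma pdist_near x (e : R) : 0 < e -> \forall y \near x, pdist y x < e.
Proof.
move=> e0; have e20 : 0 < e / 2 by rewrite divr_gt0.
pose D := Num.min (e / 2) ((e / 2) ^+ 2).
have D0 : 0 < D by rewrite lt_min e20 exprn_gt0.
exists (ball x.1 D, ball x.2 D) => /=.
  by split; apply: nbhsx_ballx.
move=> y [/=]; rewrite -!ball_normE /= !lt_min (distrC x.1) (distrC x.2).
move=> /andP[y1 _] /andP[_ y2]; rewrite [e]splitr ltrD//.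
by rewrite -[ltRHS](ger0_norm (ltW e20)) -[ltRHS]sqrtr_sqr ltr_sqrt// exprn_gt0.
Qed.

Lemma hoelder_continuous (a C : R) (u : plane R -> R) : 0 < a ->
  (forall x y, `|u y - u x| <= C * pdist y x `^ a) -> continuous u.
Proof.
move=> a0 uC x; apply/cvgrPdist_lt => e e0.
pose D := `|C| + 1; have D0 : 0 < D by rewrite ltr_wpDl.
have eD : 0 < (e / D) `^ a^-1 by rewrite powR_gt0// divr_gt0.
apply: filterS (pdist_near x eD) => y yx.
rewrite distrC (le_lt_trans (uC x y))// (@le_lt_trans _ _ (D * pdist y x `^ a))//.
  by rewrite ler_wpM2r ?powR_ge0// (le_trans (ler_norm C))// lerDl.
rewrite mulrC -ltr_pdivlMr// -[ltRHS]powRr1 ?ltW ?divr_gt0//.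
by rewrite -(mulVf (lt0r_neq0 a0)) powRrM gt0_ltr_powR// nnegrE ?pdist_ge0// ltW.
Qed.

(** The supremum bounds its set only once an upper bound exists, which is C here; the points (0, 0)
    and (1, 0) give a nonnegative member. *)
Lemma hoelder_seminormP (a C : R) (u : plane R -> R) :
  (forall x y, `|u y - u x| <= C * pdist y x `^ a) ->
  0 <= hoelder_seminorm a u /\
  forall x y, `|u y - u x| <= hoelder_seminorm a u * pdist y x `^ a.
Proof.
move=> uC; rewrite /hoelder_seminorm; set E := [set r | _].
have E_sup : has_ubound E.
  exists C => _ [x [y [xy ->]]].
  have xy0 : 0 < pdist y x by rewrite pdist_gt0// eq_sym.
  by rewrite powRN mulrC ler_pdivrMr ?powR_gt0.
have E_le x y : x != y -> pdist y x `^ (- a) * `|u y - u x| <= sup E.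
  by move=> xy; apply: ub_le_sup => //; exists x, y.
have E0 : 0 <= sup E.
  have := E_le (0, 0) (1, 0); rewrite xpair_eqE/= eq_sym oner_eq0 => /(_ isT).
  by apply: le_trans; rewrite mulr_ge0// powR_ge0.
split=> // x y; have [->|xy] := eqVneq x y.
  by rewrite subrr normr0 mulr_ge0// powR_ge0.
have xy0 : 0 < pdist y x by rewrite pdist_gt0// eq_sym.
by rewrite -ler_pdivrMr ?powR_gt0// mulrC -powRN E_le.
Qed.

End ParabolicDistance.

(** * The function u and the remainder of Vp *)

Section PositivePart.
Context {R : realType} (Tp' : abstract_space R) (alpha_gt0 : 0 < min_homog Tp').
Local Notation alpha := (min_homog Tp').
Local Notation Tp := (adjoin R^o (min_homog_gt0_neq0 alpha_gt0)).
Context (N : R) (N_gt0 : 0 < N) (N_le1 : N <= 1).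
Context (brp : idx Tp -> R) (brp_ge0 : forall i, 0 <= brp i).
Context (Gp : plane R -> graded_sum Tp -> graded_sum Tp).
Hypothesis Gp_skel : is_skeleton Gp.
Context (alphap : R) (Vp : plane R -> graded_sum Tp -> R^o).
Hypothesis Vp_D : modelled N brp Gp alphap Vp.
Context (u : plane R -> R).
Hypothesis uE : forall x (v : graded_sum Tp), cutoff Gp alpha Vp x v = u x * (v None : R).
Hypothesis alphap_gt : alpha < alphap.

Local Notation Vbar := (fun x v => Vp x v - cutoff Gp alpha Vp x v).
Local Notation one := (@dsum_inj _ _ (@piece _ Tp) None (1 : R^o)).

Let Gp_triangular : triangular Gp. Proof. by have [] := Gp_skel. Qed.
Let Vp_bounded x : bounded_linear (Vp x). Proof. by have [[]] := Vp_D. Qed.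
Let Vp_size := size_bound_norm (let: And3 _ _ s := Vp_D in s).
Let Vp_incr := increment_bound_seminorm (let: And3 _ i _ := Vp_D in i).

Lemma skeleton_none x v : Gp x v None = v None.
Proof.
apply: triangular_min => // -[i|]//=.
by rewrite (le_trans (ltW alpha_gt0))// min_homog_le.
Qed.

(** Subtracting the cutoff leaves the terms of the reduction of homogeneity at least alpha > 0, and
    the T_0 term is not among them. *)
Lemma Vbar_congr x v w : (forall i, Gp x v (Some i) = Gp x w (Some i)) ->
  Vbar x v = Vbar x w.
Proof.
move=> vw; have [_ VE] := reductionP Gp_triangular Vp_bounded.
rewrite !VE /cutoff !(bigID (fun b : idx Tp => homog b < alpha) xpredT)/=.
rewrite ![_ + _ - _]addrAC !subrr !add0r; apply: eq_bigr => -[i|] /=; last by rewrite alpha_gt0.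
by rewrite vw.
Qed.

(** Invertibility of Gp x allows deleting the T_0 component of Gp x v. A bound tested on v' then
    becomes a bound on [Vbar x v] without T_0 term. *)
Lemma Vbar_lift x v : exists v', [/\ Gp x v' None = 0,
  forall i, Gp x v' (Some i) = Gp x v (Some i), Vbar x v' = Vbar x v & Vp x v' = Vbar x v].
Proof.
have [H [_ _ HK]] := triangular_inverse Gp_triangular x.
pose v' := H (Gp x v - @dsum_inj _ _ (@piece _ Tp) None (Gp x v None)).
have v'N : Gp x v' None = 0 by rewrite HK dsum_addE dsum_oppE dsum_injE subrr.
have v'S i : Gp x v' (Some i) = Gp x v (Some i).
  by rewrite HK dsum_addE dsum_oppE dsum_inj_neq// subr0.
exists v'; split=> //; first exact: Vbar_congr.
rewrite -(Vbar_congr v'S) /= uE -(skeleton_none x) v'N.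
by rewrite [X in _ - X]mulr0 subr0.
Qed.

(** The constant of Vp serves to show that Vbar has a finite norm and that u is Hoelder; the own
    constant of Vbar is the one that enters M^c. *)
Lemma Vbar_bound C : size_bound N brp Gp Vp C \/ size_bound N brp Gp Vbar C ->
  forall x v, `|Vbar x v| <= C * \sum_i N `^ brp (Some i) * `|Gp x v (Some i)|.
Proof.
move=> VC x v; have [v' [v'N v'S v'bar v'V]] := Vbar_lift x v.
have sumE : \sum_b N `^ brp b * `|Gp x v' b| =
    \sum_i N `^ brp (Some i) * `|Gp x v (Some i)|.
  rewrite big_option/= v'N normr0 mulr0 add0r.
  by apply: eq_bigr => i _; rewrite v'S.
by rewrite -sumE; case: VC => -[_ VC]; [rewrite -v'V|rewrite -v'bar]; exact: VC.
Qed.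

Lemma Vbar_size_bound : size_bound N brp Gp Vbar (modelled_norm N brp Gp Vbar).
Proof.
apply: size_bound_norm; exists (modelled_norm N brp Gp Vp).
have [V0 _] := Vp_size; split=> // x v.
rewrite (le_trans (Vbar_bound (or_introl Vp_size) x v))// ler_wpM2l//.
by rewrite [leRHS]big_option/= lerDr mulr_ge0// powR_ge0.
Qed.

(* Testing Vp on this v reads off u. *)
Lemma one_lift x : exists v, [/\ Gp x v = one, v None = 1 :> R & Vp x v = u x].
Proof.
have [H [_ _ HK]] := triangular_inverse Gp_triangular x.
have vN : H one None = 1 :> R by rewrite -(skeleton_none x) HK dsum_injE.
exists (H one); split=> //.
have Vl := bounded_linear_lin (Vp_bounded x).
have -> : Vp x (H one) = Vbar x (H one) + u x * (H one None : R).
  by rewrite -uE /= subrK.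
rewrite vN mulr1 (@Vbar_congr x _ 0) => [|i].
  by rewrite /= uE (lin0 Vl) [X in _ - X]mulr0 subr0 add0r.
have [Gb _ _] := Gp_skel; have [Gb' _] := Gb.
by rewrite HK (lin0 (bounded_linear_lin (Gb' x))) dsum_inj_neq.
Qed.

Lemma sum_one (F : idx Tp -> R) : \sum_b F b * `|one b| = F None.
Proof.
rewrite big_option/= dsum_injE normr1 mulr1 big1 ?addr0// => i _.
by rewrite dsum_inj_neq// normr0 mulr0.
Qed.

Lemma u_bound x : `|u x| <= modelled_norm N brp Gp Vp.
Proof.
have [v [vG _ <-]] := one_lift x; have [V0 VC] := Vp_size.
rewrite (le_trans (VC x v))// vG sum_one -[leRHS]mulr1 ler_wpM2l//.
by rewrite -(powRr0 N) ger_powR// N_gt0.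
Qed.

Lemma u_sup_norm x : `|u x| <= sup_norm u.
Proof.
apply: ub_le_sup; last by exists x.
by exists (modelled_norm N brp Gp Vp) => _ [y _ <-]; exact: u_bound.
Qed.

(** For d <= 1, test on the v of [one_lift] at x: u y - u x is (Vp y - Vp x).v - Vbar(y).v. The
    first term is at most I d^alphap, as only T_0 contributes. In the second, each component of Gp y
    v above T_0 vanishes at x, so the skeleton bound makes it at most D d^(homog i) <= D d^alpha.
    For d > 1 the boundedness of u suffices. *)
Lemma u_hoelder : exists C, forall x y, `|u y - u x| <= C * pdist y x `^ alpha.
Proof.
have [V0 VC] := Vp_size; have [I0 IC] := Vp_incr.
have [_ _ [D [D0 DC]]] := Gp_skel.
set V := modelled_norm N brp Gp Vp in V0 VC *.
set I := modelled_seminorm Gp alphap Vp in I0 IC *.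
pose C := I + V * (#|idx Tp'|%:R * D).
have C0 : 0 <= C by rewrite addr_ge0// !mulr_ge0.
exists (C + 2 * V) => x y; have d0 := pdist_ge0 y x; set d := pdist y x in d0 *.
have [d1|d1] := leP d 1; last first.
  have dp : 1 <= d `^ alpha.
    by rewrite -(powRr0 d) ler_powR// ltW.
  rewrite (le_trans (ler_normB _ _))//.
  rewrite (@le_trans _ _ (2 * V))//.
    by rewrite mulr_natl mulr2n lerD// u_bound.
  by rewrite -[leLHS]mulr1 ler_pM// ?mulr_ge0// lerDr.
have [v [vG vN vV]] := one_lift x.
have -> : u y - u x = (Vp y v - Vp x v) - Vbar y v.
  by rewrite vV uE vN mulr1 opprB [in RHS]addrC addrA subrK.
rewrite (@le_trans _ _ (C * d `^ alpha))//; last first.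
  by rewrite ler_wpM2r ?powR_ge0// lerDl mulr_ge0.
rewrite (le_trans (ler_normB _ _))// /C mulrDl lerD//.
  rewrite (le_trans (IC x y v d1))// vG sum_one ler_wpM2l// subr0.
  by rewrite powR_le1 ?d0// ?le_max ?(ltW alpha_gt0) ?(ltW alphap_gt).
rewrite (le_trans (Vbar_bound (or_introl Vp_size) y v))// -/V -mulrA ler_wpM2l//.
rewrite -mulrA mulr_natl -sumr_const; apply: ler_sum => i _.
rewrite -[leRHS]mul1r; apply: ler_pM; rewrite ?powR_ge0//.
  by rewrite -(powRr0 N) ger_powR// N_gt0.
have -> : Gp y v (Some i) = Gp y v (Some i) - Gp x v (Some i).
  by rewrite vG dsum_inj_neq// subr0.
rewrite (le_trans (DC x y (Some i) v d1))// ler_wpM2l// vG big_mkcond/=.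
pose F (c : idx Tp) := if homog c < homog i then
  d `^ (homog i - homog c) else 0.
rewrite (eq_bigr (fun c => F c * `|one c|)) => [|c _]; last first.
  by rewrite /F; case: ifP => // _; rewrite mul0r.
have i0 : alpha <= homog i by exact: min_homog_le.
rewrite sum_one /F /= (lt_le_trans alpha_gt0 i0) subr0.
by rewrite powR_le1 ?d0// ltW.
Qed.

End PositivePart.

(** * The extension *)

Section MinusPart.
Context {R : realType} {Sp' Sm : abstract_space R}.
Context {Sp'0 : forall i : idx Sp', homog i != 0}.
Local Notation Sp := (adjoin R^o Sp'0).
Context (K : tensor_system Sp Sm) (K_uniform : uniform_crossnorm K).
Local Notation Z := (graded_sum (prod_space K)).
Local Notation ppure := (@prod_pure R Sp Sm K).
Local Notation none := (None : idx Sp).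
Local Notation mul := (fun a b : R^o => a * b).

Lemma minus_part_iso j : exists psi : tens K (Piece none) (Piece j) -> piece j,
  [/\ linear psi, forall z, `|psi z| = `|z|,
      forall v : Z, minus_part v j = psi (component v none j)
    & forall (a : R^o) w,
        psi (pure K (c := Piece none) (d := Piece j) a w) = (a : R) *: w].
Proof.
have [Kc _ _ _] := K_uniform.
have [psi [pl pn pE]] := scalar_tensor (Kc (Piece none) (Piece j)).
exists psi; split=> // v; rewrite /minus_part.
apply: (tensor_op_eq (B := psi) (@pure_determining _ _ _ _ K_uniform _ _)).
by split=> //; exact: bounded_linear_isometry.
Qed.

Lemma norm_minus_part (v : Z) j : `|minus_part v j| = `|component v none j|.
Proof. by have [psi [_ pn -> _]] := minus_part_iso j. Qed.

Lemma bounded_linear_minus_part : bounded_linear (@minus_part R Sp' Sm Sp'0 K).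
Proof.
apply: bounded_linear_dsum => j; have [psi [pl pn pE _]] := minus_part_iso j.
have := bounded_linear_comp (bounded_linear_isometry pl pn)
  (bounded_linear_component K none j).
by congr bounded_linear; apply/funext => v; rewrite pE.
Qed.

Lemma minus_part_pure (u : graded_sum Sp) (v : graded_sum Sm) :
  minus_part (ppure u v) = (u None : R) *: v.
Proof.
apply: dsum_ext => j; have [psi [_ _ -> pE]] := minus_part_iso j.
by rewrite component_prod_pure pE.
Qed.

Let real_findim : finite_dimensional R^o.
Proof.
exists 1%N, (fun=> 1); move=> v; exists (fun=> v).
by rewrite big_ord1 [RHS]mulr1.
Qed.

(** Forms take values in R (x) R. As R is an admissible finite-dimensional factor, multiplication
    identifies this space isometrically with R, and the general results on tensor operators apply to
    [tensor_form]. *)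
Lemma realizes_mul : exists psi,
  @realizes _ _ _ K (Findim _ real_findim) (Findim _ real_findim) R^o mul psi.
Proof.
have [Kc _ _ _] := K_uniform.
have [psi [pl pn pE]] := scalar_tensor (Kc (Findim _ real_findim) (Findim _ real_findim)).
by exists psi.
Qed.

(** Identifies the product of u pi_0 with Vm as u Vm.v_-, the term exchanged between u u_- + Vp_bar
    (x) Vm and u Gbar_{kappa-alpha} + Vp (x) Vm. *)
Lemma tensor_form_none (W : graded_sum Sm -> R^o) (v : Z) : bounded_linear W ->
  tensor_form (fun u : graded_sum Sp => u None : R^o) W v = W (minus_part v).
Proof.
move=> Wb; move: v; refine (tensor_op_eq (prod_pure_determining K_uniform) _).
split=> [|u v]; first exact: (bounded_linear_comp Wb bounded_linear_minus_part).
by rewrite minus_part_pure (linZ (bounded_linear_lin Wb)).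
Qed.

(** On u (x) v both sides are the T_0 component of u times Gm v, as Gp fixes that component. Thus
    bounds on Vm tested on v_- are expressed by components (0, beta_-) of G x v. *)
Lemma skeleton_minus_part (Gp : graded_sum Sp -> graded_sum Sp)
    (Gm : graded_sum Sm -> graded_sum Sm) (v : Z) :
  bounded_linear Gp -> bounded_linear Gm ->
  (forall u : graded_sum Sp, Gp u None = u None) ->
  Gm (minus_part v) = minus_part (tensor_op ppure ppure Gp Gm v).
Proof.
move=> Gpb Gmb Gp0; have [Gb GE] := prod_operatorP K_uniform Gpb Gmb.
move: v; apply: (prod_pure_determining K_uniform
  (bounded_linear_comp Gmb bounded_linear_minus_part)
  (bounded_linear_comp bounded_linear_minus_part Gb)) => u v.
by rewrite GE !minus_part_pure (linZ (bounded_linear_lin Gmb)) Gp0.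
Qed.

End MinusPart.

Section Extension.
Context {R : realType} {Sp' Sm : abstract_space R}.
Context {Sp'0 : forall i : idx Sp', homog i != 0}.
Local Notation Sp := (adjoin R^o Sp'0).
Context (K : tensor_system Sp Sm) (K_uniform : uniform_crossnorm K).
Context (Gp : plane R -> graded_sum Sp -> graded_sum Sp).
Context (Gm : plane R -> graded_sum Sm -> graded_sum Sm).
Hypotheses (Gp_skel : is_skeleton Gp) (Gm_skel : is_skeleton Gm).
Hypothesis Gp_none : forall x v, Gp x v None = v None.
Context (ka : R) (hka : forall b : idx (prod_space K), homog b != ka).
Hypothesis ka_gt : forall j : idx Sm, homog j < ka.
Context (Ns : {posnum R}) (am : R) (ka_le : ka <= am).
Context (Vm : plane R -> graded_sum Sm -> R^o) (Vm_C0 : C0_op Vm).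
Local Notation Tbar := (adjoin (scaled_line Ns) hka).
Local Notation Z := (graded_sum (prod_space K)).
Local Notation G := (prod_skeleton (K := K) Gp Gm).
Local Notation Gbar := (ext_skeleton Vm G : plane R -> graded_sum Tbar -> graded_sum Tbar).
Local Notation rest := (@adjoin_rest R ka (scaled_line Ns) (prod_space K) hka).

Let Gp_bounded x : bounded_linear (Gp x). Proof. by have [[]] := Gp_skel. Qed.
Let Gm_bounded x : bounded_linear (Gm x). Proof. by have [[]] := Gm_skel. Qed.
Let Vm_bounded x : bounded_linear (Vm x). Proof. by have [] := Vm_C0. Qed.

Lemma bounded_linear_adjoin_rest : bounded_linear rest.
Proof.
apply: bounded_linear_dsum => b.
exact: (bounded_linear_coord (@piece _ Tbar) (Some b)).
Qed.

Lemma bounded_linear_scaled_line :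
  bounded_linear (fun a : R^o => a : scaled_line Ns).
Proof. by split=> //; exists Ns%:num^-1 => v; rewrite scaled_normE. Qed.

Lemma bounded_linear_unscaled_line :
  bounded_linear (fun a : scaled_line Ns => a : R^o).
Proof.
split=> //; exists Ns%:num => v.
by rewrite scaled_normE mulrA mulfV ?mul1r.
Qed.

Lemma C0_ext_skeleton : C0_op Gbar.
Proof.
apply: C0_op_dsum => -[b|].
  have Gc := C0_prod_skeleton K_uniform Gp_skel Gm_skel.
  exact: (C0_op_compr (C0_op_comp (bounded_linear_coord (@piece _ (prod_space K)) b) Gc)
    bounded_linear_adjoin_rest).
have mb := bounded_linear_comp (bounded_linear_minus_part K_uniform)
  bounded_linear_adjoin_rest.
exact: (C0_opD (C0_op_const (bounded_linear_coord (@piece _ Tbar) None))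
  (C0_op_comp bounded_linear_scaled_line (C0_opN (C0_op_compr Vm_C0 mb)))).
Qed.

(** Only the pairs (0, j) enter v_-, and their homogeneities lie below ka. *)
Lemma minus_part_inj0 (c : idx (prod_space K)) (w : piece c) : ka <= homog c ->
  minus_part (@dsum_inj _ _ (@piece _ (prod_space K)) c w) = 0.
Proof.
move=> kac; apply: dsum_ext => j; apply/normr0_eq0.
rewrite norm_minus_part// /component dsum_inj_neq ?normr0//.
by apply: contraTneq kac => ->; rewrite -ltNge /= add0r ka_gt.
Qed.

Lemma ext_skeleton_triangular : triangular Gbar.
Proof.
have [g [gb GE]] := prod_skeleton_triangular K_uniform Gp_skel Gm_skel.
have mb := bounded_linear_minus_part K_uniform.
pose m (c : idx (prod_space K)) (w : piece c) : graded_sum Sm :=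
  minus_part (@dsum_inj _ _ (@piece _ (prod_space K)) c w).
have m_bounded c : bounded_linear (m c).
  exact: (bounded_linear_comp mb (bounded_linear_dsum_inj (@piece _ (prod_space K)) c)).
(* The column of the new index is zero, since u_- enters no other row. In the new row the
   coefficient of piece c is minus Vm composed with v_-, which vanishes unless homog c < ka. *)
exists (fun x o o' =>
  match o return @piece _ Tbar o' -> @piece _ Tbar o with
  | Some b => match o' return @piece _ Tbar o' -> piece b with
              | Some c => @g x b c | None => fun=> 0 end
  | None => match o' return @piece _ Tbar o' -> scaled_line Ns with
              | Some c => fun w => - Vm x (m c w) : R^o | None => fun=> 0 end
  end); split=> [x [b|] [c|]|x w [b|]].
- exact: gb.
- exact: bounded_linear0.
- exact: (bounded_linear_comp bounded_linear_scaled_line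
    (bounded_linearN (bounded_linear_comp (Vm_bounded x) (m_bounded c)))).
- exact: bounded_linear0.
- rewrite big_option/= if_same add0r; exact: GE.
- rewrite big_option/= if_same add0r; congr (_ + _).
  have Vl := bounded_linear_lin (Vm_bounded x).
  rewrite {1}[rest w](@dsum_decomp _ _ (@piece _ (prod_space K))).
  rewrite (lin_sum (bounded_linear_lin mb)) (lin_sum Vl) -sumrN.
  rewrite [RHS]big_mkcond/=; apply: eq_bigr => c _; case: ifPn => //.
  by rewrite -leNgt => /minus_part_inj0 ->; rewrite (lin0 Vl) oppr0.
Qed.

Lemma sum_none (F : R -> R) x v :
  \sum_j F (homog j) * `|Gm x (minus_part v) j| =
  \sum_j F (homog (prod_idx K (None : idx Sp) j)) *
     `|component (G x v) (None : idx Sp) j|.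
Proof.
apply: eq_bigr => j _ /=; rewrite add0r; congr (_ * _).
rewrite (skeleton_minus_part K_uniform v (Gp_bounded x) (Gm_bounded x) (Gp_none x)).
exact: norm_minus_part.
Qed.

(** The old rows keep the constant D. The new row changes by an increment of Vm, measured in the
    norm scaled by 1/Ns; since homog j < ka <= am, its weights d^(am - homog j) are at most the
    required d^(ka - homog j). *)
Lemma ext_skeleton_bound D C : skeleton_bound G D -> increment_bound Gm am Vm C ->
  skeleton_bound Gbar (D + Ns%:num^-1 * C).
Proof.
move=> [D0 GD] [C0 VC]; split=> [|x y o w dxy]; first by rewrite addr_ge0// mulr_ge0.
have d0 := pdist_ge0 y x; set d := pdist y x in dxy d0 *.
set Sr := \sum_(c | _) _.
have Sr0 : 0 <= Sr by apply: sumr_ge0 => c _; rewrite mulr_ge0// powR_ge0.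
have NC0 : 0 <= Ns%:num^-1 * C by rewrite mulr_ge0.
case: o @Sr Sr0 => [b|] Sr Sr0.
  rewrite (le_trans (GD x y b (rest w) dxy))// -/d ler_pM//.
  - by apply: sumr_ge0 => c _; rewrite mulr_ge0// powR_ge0.
  - by rewrite lerDl.
  rewrite /Sr big_option/= lerDr; case: ifP => // _.
  by rewrite mulr_ge0// powR_ge0.
rewrite mulrDl -[leLHS]add0r lerD ?mulr_ge0// -mulrA.
have GE : Gbar y w None - Gbar x w None =
    - (Vm y (minus_part (rest w)) - Vm x (minus_part (rest w))) :> R.
  have sub (a b c : R) : (c - a) - (c - b) = - (a - b) by ring.
  exact: sub.
rewrite scaled_normE ler_wpM2l// [X in `|X|]GE normrN.
rewrite (le_trans (VC x y (minus_part (rest w)) dxy))// ler_wpM2l//.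
rewrite -/d (sum_none (fun h => d `^ Num.max (am - h) 0)) /Sr big_option/= ltxx add0r.
rewrite [leRHS]big_mkcond/=.
pose F h := if h < ka then d `^ (ka - h) else 0.
rewrite [leRHS](eq_bigr (fun c : idx (prod_space K) =>
  F (homog c) * `|(G x (rest w) : Z) c|)); last first.
  by move=> c _; rewrite /F /=; case: ifP; rewrite ?mul0r.
rewrite (sum_norm_prod (fun c => F (homog c))).
rewrite [leRHS]big_option/= -[leLHS]addr0 lerD//; last first.
  apply: sumr_ge0 => i _; apply: sumr_ge0 => j _; rewrite mulr_ge0//.
  by rewrite /F; case: ifP; rewrite ?powR_ge0.
apply: ler_sum => j _; rewrite ler_wpM2r// /F add0r ka_gt.
rewrite powR_le1 ?d0// ?subr_ge0 ?le_max ?lerD2r ?ka_le//.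
by rewrite ltW.
Qed.

End Extension.

(** * Multiplication *)

Section Estimates.
Context {R : realType} {Tp' Tm : abstract_space R}.
Context (alpha_gt0 : 0 < min_homog Tp') (max_Tm_lt0 : max_homog Tm < 0).
Local Notation alpha := (min_homog Tp').
Local Notation Tp := (adjoin R^o (min_homog_gt0_neq0 alpha_gt0)).
Context (K : tensor_system Tp Tm) (K_uniform : uniform_crossnorm K).
Context (N : R) (N_gt0 : 0 < N) (N_le1 : N <= 1).
Context (brp : idx Tp -> R) (brm : idx Tm -> R) (br : idx (prod_space K) -> R).
Hypothesis brp_ge0 : forall i, 0 <= brp i.
Hypothesis br_le : forall i j, br (prod_idx K i j) <= brp i + brm j.
Context (Gp : plane R -> graded_sum Tp -> graded_sum Tp).
Context (Gm : plane R -> graded_sum Tm -> graded_sum Tm).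
Hypotheses (Gp_skel : is_skeleton Gp) (Gm_skel : is_skeleton Gm).
Context (alphap alpham : R).
Context (Vp : plane R -> graded_sum Tp -> R^o) (Vm : plane R -> graded_sum Tm -> R^o).
Hypotheses (Vp_D : modelled N brp Gp alphap Vp) (Vm_D : modelled N brm Gm alpham Vm).
Context (u : plane R -> R).
Hypothesis uE : forall x (v : graded_sum Tp), cutoff Gp alpha Vp x v = u x * (v None : R).
Context (Ns : {posnum R}).
Local Notation kappa := (Num.min (alphap + min_homog Tm) (alpha + alpham)).
Context (kappa_notin : forall b : idx (prod_space K), homog b != kappa - alpha).
Hypothesis kappa_gt : max_homog Tm < kappa - alpha.

Local Notation Z := (graded_sum (prod_space K)).
Local Notation G := (prod_skeleton (K := K) Gp Gm : plane R -> Z -> Z).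
Local Notation Tbar := (adjoin (scaled_line Ns) kappa_notin).
Local Notation Gbar := (ext_skeleton Vm G : plane R -> graded_sum Tbar -> graded_sum Tbar).
Local Notation Vp_bar := (fun (x : plane R) (v : graded_sum Tp) =>
  (Vp x v - cutoff Gp alpha Vp x v) : R^o).
Local Notation V := (prod_form u Vp_bar Vm : plane R -> graded_sum Tbar -> R^o).
Local Notation rest w := (adjoin_rest (w : graded_sum Tbar)).
Local Notation T := (tensor_form (K := K)).
Local Notation pi0 := (fun v : graded_sum Tp => v None : R^o).
Local Notation nVp := (modelled_norm N brp Gp Vp).
Local Notation nVm := (modelled_norm N brm Gm Vm).
Local Notation nVbar := (modelled_norm N brp Gp Vp_bar).
Local Notation sVp := (modelled_seminorm Gp alphap Vp).
Local Notation sVm := (modelled_seminorm Gm alpham Vm).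
Local Notation Hu := (hoelder_seminorm alpha u).
Local Notation Mb := (nVp * nVm).
Local Notation Mc := ((N `^ inf (range (fun i : idx Tp' => brp (Some i))) * nVbar
  + Hu + sVp) * sVm + N `^ inf (range brm) * sVp * nVm).

Let Gp_bounded x : bounded_linear (Gp x). Proof. by have [[]] := Gp_skel. Qed.
Let Gm_bounded x : bounded_linear (Gm x). Proof. by have [[]] := Gm_skel. Qed.
Let Vp_bounded x : bounded_linear (Vp x). Proof. by have [[]] := Vp_D. Qed.
Let Vm_bounded x : bounded_linear (Vm x). Proof. by have [[]] := Vm_D. Qed.
Let pi0_bounded : bounded_linear pi0.
Proof. exact: (bounded_linear_coord (@piece _ Tp) None). Qed.

Let kappa_le1 : kappa <= alphap + min_homog Tm.
Proof. by rewrite ge_min lexx. Qed.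

Let kappa_le2 : kappa <= alpha + alpham.
Proof. by rewrite ge_min lexx orbT. Qed.

Lemma alpha_lt_alphap : alpha < alphap.
Proof.
have := min_homog_le_max max_Tm_lt0; move: kappa_le1 kappa_gt.
by set k := Num.min _ _; lra.
Qed.

Let Gp_none x v : Gp x v None = v None.
Proof. exact: skeleton_none. Qed.

Let Hu_P : 0 <= Hu /\ forall x y, `|u y - u x| <= Hu * pdist y x `^ alpha.
Proof.
have [C uC] := u_hoelder N_gt0 N_le1 brp_ge0 Gp_skel Vp_D uE alpha_lt_alphap.
exact: hoelder_seminormP uC.
Qed.

Let Vp_barE x : Vp_bar x = fun v => Vp x v - u x *: pi0 v.
Proof. by apply/funext => v; rewrite uE. Qed.

Lemma C0_Vp_bar : C0_op Vp_bar.
Proof.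
have u_cont := hoelder_continuous alpha_gt0 (proj2 Hu_P).
have [Vpc _ _] := Vp_D.
have := C0_opD Vpc (C0_opN (C0_op_scale u_cont pi0_bounded)).
by congr C0_op; apply/funext => x; rewrite Vp_barE.
Qed.

Let Vp_bar_bounded x : bounded_linear (Vp_bar x).
Proof. by have [] := C0_Vp_bar. Qed.

Lemma tensor_form_bound x A B (a : idx Tp -> R) (b : idx Tm -> R)
    (C : R) (e : idx (prod_space K) -> R) (v : Z) :
  bounded_linear A -> bounded_linear B ->
  (forall i, 0 <= a i) -> (forall j, 0 <= b j) ->
  (forall w, `|A w| <= \sum_i a i * `|Gp x w i|) ->
  (forall w, `|B w| <= \sum_j b j * `|Gm x w j|) ->
  (forall i j, a i * b j <= C * e (prod_idx K i j)) ->
  `|T A B v| <= C * \sum_c e c * `|G x v c|.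
Proof.
move=> Ab Bb a0 b0 Aa Bb' abC; have [psi psiP] := realizes_mul K_uniform.
rewrite (le_trans (tensor_op_weighted K_uniform psiP (Gp_bounded x) (Gm_bounded x)
  Ab Bb a0 b0 Aa Bb' v))//.
rewrite (sum_norm_prod e) mulr_sumr; apply: ler_sum => i _.
rewrite mulr_sumr; apply: ler_sum => j _.
by rewrite mulrA ler_wpM2r.
Qed.

Lemma tensor_form_Vp_bar x y v :
  T (Vp_bar x) (Vm y) v = T (Vp x) (Vm y) v - u x * Vm y (minus_part v).
Proof.
have [psi psiP] := realizes_mul K_uniform.
rewrite Vp_barE /tensor_form (tensor_opBl K_uniform psiP)//; last first.
  exact: bounded_linearZ.
rewrite (tensor_opZl K_uniform psiP)//; congr (_ - _ *: _).
exact: tensor_form_none.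
Qed.

Lemma prod_formE x w :
  V x w = u x * ((w None : R) - Vm x (minus_part (rest w))) + T (Vp x) (Vm x) (rest w).
Proof. by rewrite /prod_form tensor_form_Vp_bar mulrBr addrA addrAC. Qed.

Lemma prod_form_increment x y w : V y w - V x w =
  (u y - u x) * ((w None : R) - Vm x (minus_part (rest w)))
  + T (Vp_bar y) (fun v => Vm y v - Vm x v) (rest w)
  + T (fun v => Vp y v - Vp x v) (Vm x) (rest w).
Proof.
have [psi psiP] := realizes_mul K_uniform.
have -> : T (Vp_bar y) (fun v => Vm y v - Vm x v) (rest w) =
    T (Vp_bar y) (Vm y) (rest w) - T (Vp_bar y) (Vm x) (rest w).
  by rewrite /tensor_form (tensor_opBr K_uniform psiP).
have -> : T (fun v => Vp y v - Vp x v) (Vm x) (rest w) =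
    T (Vp y) (Vm x) (rest w) - T (Vp x) (Vm x) (rest w).
  by rewrite /tensor_form (tensor_opBl K_uniform psiP).
rewrite /prod_form !tensor_form_Vp_bar.
set a := w None; set m := Vm x _; set n := Vm y _.
set p := T _ _ _; set q := T _ _ _; set r := T (Vp y) (Vm x) _.
have calc (u1 u0 a1 m0 m1 t0 t1 t2 : R) :
  u1 * a1 + (t0 - u1 * m1) - (u0 * a1 + (t1 - u0 * m0)) =
  (u1 - u0) * (a1 - m0) + (t0 - u1 * m1 - (t2 - u1 * m0)) + (t2 - t1) by ring.
exact: calc.
Qed.

Lemma norm_ext_none x w : Ns%:num * `|Gbar x w None| =
  `|(w None : R) - Vm x (minus_part (rest w))|.
Proof. by rewrite scaled_normE mulrA mulfV ?mul1r. Qed.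

Lemma prod_form_size x w :
  `|V x w| <= Ns%:num * sup_norm u * `|Gbar x w None|
    + Mb * \sum_b N `^ br b * `|G x (rest w) b|.
Proof.
have [nVp0 nVpP] := size_bound_norm (let: And3 _ _ s := Vp_D in s).
have [nVm0 nVmP] := size_bound_norm (let: And3 _ _ s := Vm_D in s).
rewrite prod_formE (le_trans (ler_normD _ _))// lerD//.
  rewrite normrM [Ns%:num * _]mulrC -mulrA norm_ext_none ler_wpM2r//.
  exact: (u_sup_norm N_gt0 N_le1 brp_ge0 Gp_skel Vp_D uE).
apply: (@tensor_form_bound x _ _ (fun i => nVp * N `^ brp i)
  (fun j => nVm * N `^ brm j)) => //.
- by move=> i; rewrite mulr_ge0// powR_ge0.
- by move=> j; rewrite mulr_ge0// powR_ge0.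
- by move=> v; rewrite (le_trans (nVpP x v))// mulr_sumr ler_sum// => i _; rewrite mulrA.
- by move=> v; rewrite (le_trans (nVmP x v))// mulr_sumr ler_sum// => j _; rewrite mulrA.
(* As N <= 1, the inequality between the exponents reverses into N^brp N^brm <= N^br. *)
move=> i j; rewrite mulrACA ler_wpM2l ?mulr_ge0//.
by rewrite -powRD ?(gt_eqF N_gt0) ?implybT// ger_powR// N_gt0.
Qed.

Lemma prod_form_incr x y w : pdist y x <= 1 ->
  `|V y w - V x w| <= Ns%:num * Hu * pdist y x `^ alpha * `|Gbar x w None|
    + Mc * \sum_b pdist y x `^ Num.max (kappa - homog b) 0 * `|G x (rest w) b|.
Proof.
move=> dxy; have d0 := pdist_ge0 y x; set d := pdist y x in dxy d0 *.
have d01 : 0 <= d <= 1 by rewrite d0.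
have N01 : 0 < N <= 1 by rewrite N_gt0.
have [Hu0 HuP] := Hu_P.
have [nVm0 nVmP] := size_bound_norm (let: And3 _ _ s := Vm_D in s).
have [sVp0 sVpP] := increment_bound_seminorm (let: And3 _ i _ := Vp_D in i).
have [sVm0 sVmP] := increment_bound_seminorm (let: And3 _ i _ := Vm_D in i).
have nVbar_P := Vbar_size_bound Gp_skel Vp_D uE.
have nVbar0 := proj1 nVbar_P.
have [min_j alpha_i] := (@min_homog_le _ Tm, @min_homog_le _ Tp').
have alt := alpha_lt_alphap; have al0 := alpha_gt0.
have max_ge0 (c : R) : 0 <= Num.max c 0 by rewrite le_max lexx orbT.
have max_le (b c : R) : b <= c -> Num.max b 0 <= Num.max c 0.
  by move=> bc; rewrite ge_max max_ge0 andbT le_max bc.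
have le_maxl (c : R) : c <= Num.max c 0 by rewrite le_max lexx.
have k1 := kappa_le1; have k2 := kappa_le2.
rewrite prod_form_increment -addrA (le_trans (ler_normD _ _))// lerD//.
  have -> : Ns%:num * Hu * d `^ alpha * `|Gbar x w None| =
      Hu * d `^ alpha * (Ns%:num * `|Gbar x w None|) by ring.
  by rewrite norm_ext_none normrM ler_wpM2r.
set k := Num.min (alphap + _) _ in k1 k2 *.
pose e (c : idx (prod_space K)) := d `^ Num.max (k - homog c) 0.
rewrite (le_trans (ler_normD _ _))// mulrDl lerD//.
(* Weights that bound Vp_bar(y) through Gp(x), as needed to compare at the base point x. The summand
   with nVbar is the size of Vp_bar(x), those with sVp are the increment of Vp, and the one with Hu
   is the increment of u, which acts on T_0 only. *)
- pose a (i : idx Tp) : R := if i is Some l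
    then nVbar * N `^ brp (Some l) + sVp * d `^ Num.max (alphap - homog l) 0
    else Hu * d `^ alpha + sVp * d `^ Num.max (alphap - 0) 0.
  apply: (@tensor_form_bound x _ _ a
    (fun j => sVm * d `^ Num.max (alpham - homog j) 0) _ e) => //.
  + exact: bounded_linearB.
  + by move=> [i|]; rewrite addr_ge0// mulr_ge0// powR_ge0.
  + by move=> j; rewrite mulr_ge0// powR_ge0.
  + move=> v; rewrite big_option/=.
    have -> : Vp_bar y v = Vp_bar x v + ((Vp y v - Vp x v) - (u y - u x) * (v None : R)).
      rewrite !uE; have calc (p q r s t : R) :
        p - r * t = q - s * t + (p - q - (r - s) * t) by ring.
      exact: calc.
    have h1 := Vbar_bound Gp_skel Vp_D uE (or_intror nVbar_P) x v.
    have h2 := sVpP x y v dxy; rewrite big_option/= in h2.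
    have h3 : `|(u y - u x) * (v None : R)| <= Hu * d `^ alpha * `|Gp x v None|.
      by rewrite Gp_none normrM ler_wpM2r.
    rewrite (le_trans (ler_normD _ _))// (le_trans (lerD h1 (ler_normB _ _)))//.
    rewrite (le_trans (lerD (lexx _) (lerD h2 h3)))// -/d.
    under [in leRHS]eq_bigr do rewrite mulrDl -!mulrA.
    rewrite big_split -!mulr_sumr /=.
    set p := `|Gp x v None|; set S1 := \sum_i _; set S2 := \sum_i _.
    by lra.
  + by move=> v; rewrite (le_trans (sVmP x y v dxy))// mulr_sumr ler_sum// => j _; rewrite mulrA.
  + move=> i j; set B := d `^ Num.max (alpham - homog j) 0.
    have B0 : 0 <= B by exact: powR_ge0.
    set E := e _; have E0 : 0 <= E by exact: powR_ge0.
    set M := N `^ _; have M0 : 0 <= M by exact: powR_ge0.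
    (* Each case of i produces two of the three summands that multiply sVm in M^c; the third is only
       known to be nonnegative: that of Hu for i in A_+', that of nVbar for i = 0. *)
    have h3 : 0 <= Hu * sVm * E by rewrite !mulr_ge0.
    have h4 : 0 <= nVbar * sVm * (M * E) by rewrite !mulr_ge0.
    case: i @E E0 h3 h4 => [l|] E E0 h3 h4 /=.
      have BE : B <= E.
        (* Since homog l >= alpha and kappa <= alpha + alpham, the power of d from Vm alone suffices
           here; any further power of d is at most 1. *)
        rewrite /B /E /e powR_le1 ?max_ge0//=; apply: max_le.
        by have := alpha_i l; lra.
      have t1 : N `^ brp (Some l) * B <= M * E.
        rewrite ler_pM ?powR_ge0// ger_powR//.
        exact: (ge_inf_range (fun i : idx Tp' => brp (Some i))).
      set D := d `^ _; have t2 : D * B <= E.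
        rewrite -[leRHS]mul1r ler_pM ?powR_ge0//.
        by rewrite -(powRr0 d) powR_le1// ?max_ge0.
      have h1 := ler_wpM2l (mulr_ge0 nVbar0 sVm0) t1.
      have h2 := ler_wpM2l (mulr_ge0 sVp0 sVm0) t2.
      by lra.
    set D := d `^ alpha; set D' := d `^ Num.max (alphap - 0) 0.
    (* In T_0 the homogeneity contributes nothing, so alpha must come from the left factor: from the
       Hoelder bound of u, or from alphap > alpha. *)
    have kj : k - (0 + homog j) <= alpha + Num.max (alpham - homog j) 0.
      by have := le_maxl (alpham - homog j); lra.
    have alj : 0 <= alpha + Num.max (alpham - homog j) 0.
      by rewrite addr_ge0// ltW.
    have t1 : D * B <= E.
      by rewrite powRM_le1 ?max_ge0 ?(ltW al0)//= ge_max kj.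
    have t2 : D' * B <= E.
      rewrite powRM_le1 ?max_ge0//= ge_max addr_ge0 ?max_ge0// andbT.
      by rewrite (le_trans kj)// lerD2r subr0 le_max (ltW alt).
    have h1 := ler_wpM2l (mulr_ge0 Hu0 sVm0) t1.
    have h2 := ler_wpM2l (mulr_ge0 sVp0 sVm0) t2.
    by lra.
- apply: (@tensor_form_bound x _ _ (fun i => sVp * d `^ Num.max (alphap - homog i) 0)
    (fun j => nVm * N `^ brm j) _ e) => //.
  + exact: bounded_linearB.
  + by move=> i; rewrite mulr_ge0// powR_ge0.
  + by move=> j; rewrite mulr_ge0// powR_ge0.
  + by move=> v; rewrite (le_trans (sVpP x y v dxy))// mulr_sumr ler_sum// => i _; rewrite mulrA.
  + by move=> v; rewrite (le_trans (nVmP x v))// mulr_sumr ler_sum// => j _; rewrite mulrA.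
  move=> i j; set M := N `^ _; set M' := N `^ _; set D := d `^ _; set E := e _.
  have t : D * M <= E * M'.
    rewrite ler_pM ?powR_ge0//; last by rewrite ger_powR// ge_inf_range.
    (* Here kappa <= alphap + min A_- and min A_- <= homog j give kappa - (homog i + homog j) <=
       alphap - homog i. *)
    rewrite /D /E /e powR_le1 ?max_ge0//=; apply: max_le.
    by have := min_j j; lra.
  have h := ler_wpM2l (mulr_ge0 sVp0 nVm0) t.
  by lra.
Qed.

Lemma C0_prod_form : C0_op V.
Proof.
have u_cont := hoelder_continuous alpha_gt0 (proj2 Hu_P).
have [psi psiP] := realizes_mul K_uniform; have [Vmc _ _] := Vm_D.
have Vc := C0_tensor_op K_uniform psiP C0_Vp_bar Vmc.
exact: (C0_opD (C0_op_scale u_cont (bounded_linear_comp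
    (bounded_linear_unscaled_line Ns) (bounded_linear_coord (@piece _ Tbar) None)))
  (C0_op_compr Vc (bounded_linear_adjoin_rest kappa_notin Ns))).
Qed.

Lemma prod_form_modelled (e : R) :
  modelled N (oapp br e : idx Tbar -> R) Gbar kappa V.
Proof.
have [Hu0 _] := Hu_P.
have [nVp0 _] := size_bound_norm (let: And3 _ _ s := Vp_D in s).
have [nVm0 _] := size_bound_norm (let: And3 _ _ s := Vm_D in s).
have [sVp0 _] := increment_bound_seminorm (let: And3 _ i _ := Vp_D in i).
have [sVm0 _] := increment_bound_seminorm (let: And3 _ i _ := Vm_D in i).
have [nVbar0 _] := Vbar_size_bound Gp_skel Vp_D uE.
have Ne : 0 < N `^ e by rewrite powR_gt0.
split; first exact: C0_prod_form.
- have M0 : 0 <= Mc by rewrite !(addr_ge0, mulr_ge0)// powR_ge0.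
  have A0 : 0 <= Ns%:num * Hu by rewrite mulr_ge0.
  exists (Ns%:num * Hu + Mc); split=> [|x y w dxy]; first exact: addr_ge0.
  have sumE : \sum_(b : idx Tbar) pdist y x `^ Num.max (kappa - homog b) 0 * `|Gbar x w b| =
      pdist y x `^ alpha * `|Gbar x w None|
      + \sum_b pdist y x `^ Num.max (kappa - homog b) 0 * `|G x (rest w) b|.
    (* At the new homogeneity the weight has exponent kappa - (kappa - alpha) = alpha, the power of
       d in the estimate with Hu. *)
    by rewrite big_option /= subKr (max_l (ltW alpha_gt0)).
  rewrite sumE (le_trans (prod_form_incr w dxy))//.
  set g := `|Gbar x w None|; set S := \sum_b _; set D := pdist y x `^ alpha.
  have g0 : 0 <= g by exact: normr_ge0.
  have D0 : 0 <= D by exact: powR_ge0.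
  have h1 : 0 <= Mc * (D * g) by rewrite mulr_ge0// mulr_ge0.
  have h2 : 0 <= Ns%:num * Hu * S.
    by rewrite mulr_ge0//; apply: sumr_ge0 => b _; rewrite mulr_ge0// powR_ge0.
  move: h1 h2; set M := Mc; set A := Ns%:num * Hu; lra.
- have A0 : 0 <= Ns%:num * sup_norm u.
    rewrite mulr_ge0//.
    exact: le_trans (normr_ge0 _) (u_sup_norm N_gt0 N_le1 brp_ge0 Gp_skel Vp_D uE (0, 0)).
  (* Dividing by N^e offsets the weight that the definition of the norm attaches to the new
     homogeneity, whatever e is. *)
  exists (Ns%:num * sup_norm u / N `^ e + Mb); split=> [|x w].
    by apply: addr_ge0; [rewrite divr_ge0// powR_ge0|exact: mulr_ge0].
  have sumE : \sum_(b : idx Tbar) N `^ oapp br e b * `|Gbar x w b| =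
      N `^ e * `|Gbar x w None| + \sum_b N `^ br b * `|G x (rest w) b|.
    by rewrite big_option.
  rewrite sumE (le_trans (prod_form_size x w))//.
  set g := `|Gbar x w None|; set S := \sum_b _.
  have g0 : 0 <= g by exact: normr_ge0.
  have h1 : 0 <= Mb * (N `^ e * g) by rewrite !mulr_ge0// ltW.
  have h2 : 0 <= Ns%:num * sup_norm u / N `^ e * S.
    rewrite mulr_ge0 ?divr_ge0 ?powR_ge0//.
    by apply: sumr_ge0 => b _; rewrite mulr_ge0// powR_ge0.
  have h3 : Ns%:num * sup_norm u * g = Ns%:num * sup_norm u / N `^ e * (N `^ e * g).
    by rewrite [RHS]mulrA mulfVK ?gt_eqF.
  move: h1 h2; rewrite h3; set M := Mb; set A := Ns%:num * sup_norm u / N `^ e.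
  set B := N `^ e * g; lra.
Qed.

End Estimates.

Theorem lemma3 (R : realType)
  (* (A_+', T_+') and (A_-, T_-); A_+ = {0} \cup A_+' and T_0 = R *)
  (Tp' Tm : abstract_space R)
  (alpha_gt0 : 0 < min_homog Tp') (alpha := min_homog Tp')
  (Tp := adjoin R^o (min_homog_gt0_neq0 alpha_gt0))
  (max_Tm_lt0 : max_homog Tm < 0)
  (K : tensor_system Tp Tm) (K_uniform : uniform_crossnorm K)
  (N : R) (N_gt0 : 0 < N) (N_le1 : N <= 1)
  (brp : idx Tp -> R) (brm : idx Tm -> R) (br : idx (prod_space K) -> R)
  (brp_ge0 : forall i, 0 <= brp i) (brm_ge0 : forall j, 0 <= brm j)
  (br_ge0 : forall b, 0 <= br b)
  (br_le : forall i j, br (prod_idx K i j) <= brp i + brm j)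
  (Gp : plane R -> graded_sum Tp -> graded_sum Tp) (Gm : plane R -> graded_sum Tm -> graded_sum Tm)
  (Gp_skel : is_skeleton Gp) (Gm_skel : is_skeleton Gm)
  (alphap alpham : R) (alphap_gt0 : 0 < alphap) (alpham_lt0 : alpham < 0)
  (Vp : plane R -> graded_sum Tp -> R^o) (Vm : plane R -> graded_sum Tm -> R^o)
  (Vp_D : modelled N brp Gp alphap Vp) (Vm_D : modelled N brm Gm alpham Vm)
  (u : plane R -> R)
  (uE : forall x (v : graded_sum Tp), cutoff Gp alpha Vp x v = u x * (v None : R))
  (Ns : {posnum R})
  (kappa := Num.min (alphap + min_homog Tm) (alpha + alpham))
  (kappa_notin : forall b : idx (prod_space K), homog b != kappa - alpha)
  (kappa_gt : max_homog Tm < kappa - alpha) :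
  let G := prod_skeleton (K := K) Gp Gm in
  let Tbar := adjoin (scaled_line Ns) kappa_notin in
  let Gbar : plane R -> graded_sum Tbar -> graded_sum Tbar := ext_skeleton Vm G in
  let Vp_bar : plane R -> graded_sum Tp -> R^o :=
    fun x v => Vp x v - cutoff Gp alpha Vp x v in
  let V : plane R -> graded_sum Tbar -> R^o := prod_form u Vp_bar Vm in
  let Mb := modelled_norm N brp Gp Vp * modelled_norm N brm Gm Vm in
  let Mc :=
    (N `^ inf (range (fun i : idx Tp' => brp (Some i)))
       * modelled_norm N brp Gp Vp_bar
     + hoelder_seminorm alpha u
     + modelled_seminorm Gp alphap Vp) * modelled_seminorm Gm alpham Vm
    + N `^ inf (range brm)
      * modelled_seminorm Gp alphap Vp * modelled_norm N brm Gm Vm in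
  [/\ is_skeleton Gbar,
      skeleton_norm Gbar <=
        skeleton_norm G + Ns%:num^-1 * modelled_seminorm Gm alpham Vm,
      (* the exponent e of the new homogeneity kappa - alpha is arbitrary *)
      forall e : R, 0 <= e ->
        modelled N (oapp br e : idx Tbar -> R) Gbar kappa V,
      forall x w,
        `|V x w| <= Ns%:num * sup_norm u * `|Gbar x w None|
          + Mb * \sum_b N `^ br b * `|G x (adjoin_rest w) b|
    & forall x y w, pdist y x <= 1 ->
        `|V y w - V x w| <=
          Ns%:num * hoelder_seminorm alpha u * pdist y x `^ alpha
            * `|Gbar x w None|
          + Mc * \sum_b pdist y x `^ Num.max (kappa - homog b) 0
                        * `|G x (adjoin_rest w) b| ].
Proof.
move=> G Tbar Gbar Vp_bar V Mb Mc.
have Gp_none x v : Gp x v None = v None by exact: skeleton_none.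
have Vm_C0 : C0_op Vm by have [] := Vm_D.
have [_ Vm_incr _] := Vm_D.
have ka_gt (j : idx Tm) : homog j < kappa - alpha.
  by rewrite (le_lt_trans (max_homog_ge j)).
have ka_le : kappa - alpha <= alpham.
  by rewrite lerBlDl ge_min lexx orbT.
have G_bound := skeleton_bound_norm (prod_skeleton_boundP K_uniform Gp_skel Gm_skel).
have Gbar_bound := ext_skeleton_bound K_uniform Gp_skel Gm_skel Gp_none kappa_notin
  ka_gt Ns ka_le G_bound (increment_bound_seminorm Vm_incr).
split.
- split; last by eexists; exact: Gbar_bound.
    exact: C0_ext_skeleton.
  exact: ext_skeleton_triangular.
- apply: ge_inf Gbar_bound.
  by exists 0 => C [].
- move=> e _; exact: (prod_form_modelled max_Tm_lt0 K_uniform N_gt0 N_le1 brp_ge0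
    br_le Gp_skel Gm_skel Vp_D Vm_D uE Ns kappa_notin kappa_gt e).
- exact: (prod_form_size K_uniform N_gt0 N_le1 brp_ge0 br_le Gp_skel Gm_skel
    Vp_D Vm_D uE).
- move=> x y w; exact: (prod_form_incr max_Tm_lt0 K_uniform N_gt0 N_le1 brp_ge0
    Gp_skel Gm_skel Vp_D Vm_D uE kappa_gt w).
Qed.
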